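(* There is a universal constant $C>0$ such that the following holds. Let $\sigma>0$, $V\ge0$, let $n,m\ge1$ be integers, let $(A_1,\dots,A_m)$ be a partition of $[n]=\{1,\dots,n\}$ into consecutive intervals, let $\theta^*\in\mathbb{R}^n$, and suppose that: (a) the partition is equi-spaced: $|A_1|=|A_2|=\dots=|A_m|\ (=n/m)$, with $n/m\ge2$; (b) for each $j=1,\dots,m$, the subvector $\theta^*_{A_j}$ is monotone (nondecreasing) and $\mathcal V(\theta^*_{A_j})\le V/m$; (c) for each $j=1,\dots,m$, $\theta^*_{A_j}$ satisfies the moderate growth condition. Then the nearly-isotonic regression estimator $\hat\theta_\lambda$ with optimally tuned parameter (i.e. for some $\lambda\ge0$, which may depend on $\theta^*$, $\sigma$, $n$) satisfies $$\frac1n\mathbb{E}_{\theta^*}\|\hat\theta_\lambda-\theta^*\|_2^2\le C\max\left\{\left(\frac{\sigma^2V\log\frac{en}{m}}{n}\right)^{2/3},\ \frac{\sigma^2m}{n}\log\frac{en}{m}\right\}.$$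
   Context: $y\sim N(\theta^*,\sigma^2I_n)$, and $\mathbb{E}_{\theta^*}$ is with respect to $y$. For $\lambda\ge0$, $$\hat\theta_\lambda=\operatorname*{argmin}_{\theta\in\mathbb{R}^n}\left\{\frac12\|y-\theta\|_2^2+\lambda\sum_{i=1}^{n-1}(\theta_i-\theta_{i+1})_+\right\},\qquad(z)_+=\max\{z,0\}.$$ For $u\in\mathbb{R}^N$, $\mathcal V(u)=\sum_{i=1}^{N-1}|u_i-u_{i+1}|$ (so $\mathcal V(u)=u_N-u_1$ for nondecreasing $u$). Moderate growth condition: for $N\ge2$, a nondecreasing vector $u\in\mathbb{R}^N$ satisfies it if $$u_i\le u_1+\frac{i-1}{N-1}\mathcal V(u)\quad\text{for }i=1,2,\dots,\lceil N/2\rceil$$ and $$u_i\ge u_1+\frac{i-1}{N-1}\mathcal V(u)\quad\text{for }i=\lceil N/2\rceil,\lceil N/2\rceil+1,\dots,N.$$ *)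

(* Defs.v *)
From HB Require Import structures.
From mathcomp Require Import all_boot all_order all_algebra.
From mathcomp Require Import all_classical all_reals all_analysis.
Import Order.TTheory GRing.Theory Num.Theory.
Import numFieldNormedType.Exports.

Set Implicit Arguments.
Unset Strict Implicit.
Unset Printing Implicit Defensive.

Local Open Scope classical_set_scope.
Local Open Scope ring_scope.

(** Indices are 0-based: the paper's [u_i] is [u 0 (i - 1)]. *)

Definition sq_l2norm (R : realType) (N : nat) (u : 'rV[R]_N) : R :=
  \sum_(i < N) u 0 i ^+ 2.

(** The double sums below have exactly one term for each pair of adjacent
    indices [(i, i + 1)]. *)
Definition vector_variation (R : realType) (N : nat) (u : 'rV[R]_N) : R :=
  \sum_(i < N) \sum_(k < N | k == i.+1 :> nat) `|u 0 i - u 0 k|.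

Definition nearly_isotonic_penalty (R : realType) (N : nat) (u : 'rV[R]_N) : R :=
  \sum_(i < N) \sum_(k < N | k == i.+1 :> nat) Num.max (u 0 i - u 0 k) 0.

Definition nearly_isotonic_objective (R : realType) (n : nat) (lambda : R)
    (y theta : 'rV[R]_n) : R :=
  2^-1 * sq_l2norm (y - theta) + lambda * nearly_isotonic_penalty theta.

(** For [lambda >= 0] the objective is continuous, coercive and strictly convex
    in [theta], so the set of minimizers is a singleton and the default value
    [0] of [xget] plays no role. *)
Definition nearly_isotonic_estimator (R : realType) (n : nat) (lambda : R)
    (y : 'rV[R]_n) : 'rV[R]_n :=
  xget 0 [set theta | forall theta',
    nearly_isotonic_objective lambda y theta <=
    nearly_isotonic_objective lambda y theta'].

Definition nondecreasing_vector (R : realType) (N : nat) (u : 'rV[R]_N) : Prop :=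
  forall i k : 'I_N, (i <= k)%N -> u 0 i <= u 0 k.

(** [i0] is the index of the first coordinate and [i.+1] the 1-based position
    of [i]; [uphalf N] is the ceiling of [N / 2].  Meant for nondecreasing [u]
    with [2 <= N]. *)
Definition moderate_growth (R : realType) (N : nat) (u : 'rV[R]_N) : Prop :=
  forall i0 i : 'I_N, i0 = 0%N :> nat ->
    ((i.+1 <= uphalf N)%N ->
       u 0 i <= u 0 i0 + i%:R / N.-1%:R * vector_variation u) /\
    ((uphalf N <= i.+1)%N ->
       u 0 i >= u 0 i0 + i%:R / N.-1%:R * vector_variation u).

(** [enum_val] lists the elements of [A] in increasing order. *)
Definition subvector (R : realType) (n : nat) (theta : 'rV[R]_n)
    (A : {set 'I_n}) : 'rV[R]_#|A| :=
  \row_(k < #|A|) theta 0 (enum_val k).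

Definition consecutive_interval_partition (n m : nat)
    (A : 'I_m -> {set 'I_n}) : Prop :=
  [/\ forall j, exists i, i \in A j,
      forall i, exists! j, i \in A j,
      forall j (i k l : 'I_n), i \in A j -> l \in A j ->
        (i <= k <= l)%N -> k \in A j
    & forall (j j' : 'I_m) (i i' : 'I_n), (j < j')%N ->
        i \in A j -> i' \in A j' -> (i < i')%N].

(** Taking some [B i] to be the whole line gives the product rule for all
    subfamilies. *)
Definition mutually_independent (R : realType) (d : measure_display)
    (T : measurableType d) (P : probability T R) (n : nat)
    (Y : 'I_n -> {RV P >-> R}) : Prop :=
  forall B : 'I_n -> set R, (forall i, measurable (B i)) ->
    P [set w | forall i, B i (Y i w)] = (\prod_(i < n) P (Y i @^-1` B i))%E.

(** [Y] has law N(theta, sigma^2 I_n).  The marginal laws are compared on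
    measurable sets only, since measures are total functions on sets. *)
Definition gaussian_vector (R : realType) (d : measure_display)
    (T : measurableType d) (P : probability T R) (n : nat)
    (Y : 'I_n -> {RV P >-> R}) (theta : 'rV[R]_n) (sigma : R) : Prop :=
  (forall i (B : set R), measurable B ->
     distribution P (Y i) B = normal_prob (theta 0 i) sigma B) /\
  mutually_independent Y.

(* Main.v *)
Require Import Defs.
From HB Require Import structures.
From mathcomp Require Import all_boot all_order all_algebra.
From mathcomp Require Import all_classical all_reals all_analysis.
From mathcomp Require Import measurable_realfun ring lra zify.
Import Order.TTheory GRing.Theory Num.Theory.
Import numFieldNormedType.Exports.
Local Open Scope classical_set_scope.
Local Open Scope ring_scope.
Set Implicit Arguments.
Unset Strict Implicit.
Unset Printing Implicit Defensive.
(** Why the bound holds.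

    Deterministic part.  The estimator is the proximal point of a polyhedral
    penalty, so it satisfies a pathwise oracle inequality [estimator_oracle]:
    for every vector [th] and every dual path [W],
      |hat - theta|^2
        <= |th - theta|^2 + sum_i (z_i - (W_(i+1) - W_i))^2,  z = y - theta.
    A dual path lives on the edges between neighbouring coordinates, takes
    values in [0, lambda], vanishes beyond both ends, equals lambda on the
    edges where [th] drops and 0 on those where it increases, and is free where
    [th] is constant.  All that remains is to choose [th] from theta and [W]
    from the noise z.

    The vector [th] is constant on blocks of length at most h.  Write v = V/m,
    N = n/m and r = 2 h v / N.  Cutting a monotone piece greedily whenever theta
    has moved by r, or h steps have been made, leaves O(N/h) blocks
    ([greedy_segment]).  The two ends of a piece are special: theta may drop
    between two pieces, and then [W] has to be lambda there and to come back to
    0 inside the piece.  Doing so over 2h steps costs O(lambda^2/h), but forces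
    [th] to be constant on the first and last 2h coordinates; the moderate
    growth condition is exactly what bounds the oscillation of theta by r there
    ([piece_bounds]).

    On one block [W] starts and ends at 0.  With S the partial sums of the noise
    and M = S - W, the cost is the energy of a path M lying below S with the
    same end points.  Interpolating the running minima of S along dyadic times,
    from both ends, gives O(log h) linear pieces; at the scale 2^q the energy
    is (running minimum)^2 / 2^q, of mean O(sigma^2) ([dyadic_block_path]).
    Such a W stays below lambda/2 as soon as S oscillates by at most
    Lam = lambda/2; taking Lam^2 = 12 sigma^2 h log(eN), the opposite event has
    a probability polynomially small in N, and W = 0 is good enough on it
    ([block_dual], [block_cost_mean]).

    Probabilistic part.  Independence enters through the factorization
    E[g f(Y_i)] = E[g] E[f(Y_i)], where g does not depend on Y_i
    ([free_of_integralM], by Dynkin's lemma).  It yields the moment generating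
    function of linear forms of the noise ([noise_mgf]) and, with a pathwise
    form of Doob's inequality, E[max_(s <= t) S_s^2] = O(t sigma^2)
    ([noise_rmax_sqr]).

    Altogether the risk is at most C (h^2 V^2 / n^2 + sigma^2 log(eN) / h)
    ([risk_penalized]), and the best integer h in [1, N/4] gives the rate
    ([block_length_choice]).  When N < 4, or when even h = 1 is too long,
    lambda = 0 suffices: the estimator is then y, with risk O(sigma^2). *)

(** * Integration *)

Import HBNNSimple.

(** Both sides agree on indicators by the choice of [nu], hence on simple
    functions, and monotone convergence passes to the limit. *)
Lemma ge0_integral_density (R : realType) d (T : measurableType d)
    (mu nu : {measure set T -> \bar R}) (g : T -> R) (f : T -> \bar R) :
    measurable_fun setT g -> (forall x, 0 <= g x) ->
    (forall A, measurable A -> nu A = (\int[mu]_(x in A) (g x)%:E)%E) ->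
    measurable_fun setT f -> (forall x, (0 <= f x)%E) ->
  (\int[nu]_x f x = \int[mu]_x (f x * (g x)%:E))%E.
Proof.
move=> mg g0 nuE mf f0.
pose f_ := nnsfun_approx measurableT mf.
have cvgf x : (f_ n x)%:E @[n --> \oo] --> f x.
  by apply: (cvg_nnsfun_approx measurableT mf).
have nf x : {homo (fun n => (f_ n x)%:E) : m n / (m <= n)%N >-> (m <= n)%E}.
  by move=> m n mn; rewrite lee_fin; exact/lefP/nd_nnsfun_approx.
transitivity (limn (fun n => \int[nu]_x (f_ n x)%:E)%E).
  rewrite -monotone_convergence//; first last.
    by move=> n y _; rewrite lee_fin.
    by move=> n; exact/measurable_EFinP/measurable_funP.
  by apply: eq_integral => y _; apply/esym/cvg_lim.
transitivity (limn (fun n => \int[mu]_x ((f_ n x)%:E * (g x)%:E))%E); last first.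
  rewrite -monotone_convergence//; first last.
  - by move=> y _ m n mn; rewrite lee_wpmul2r// ?lee_fin//; exact/lefP/nd_nnsfun_approx.
  - by move=> n y _; rewrite mule_ge0// lee_fin.
  - move=> n; apply: emeasurable_funM => //; last exact/measurable_EFinP.
    exact/measurable_EFinP/measurable_funP.
  - apply: eq_integral => y _; apply/cvg_lim => //.
    exact: cvgeZr.
congr (limn _); apply/funext => n.
transitivity (\sum_(k \in range (f_ n)) (k%:E * nu (f_ n @^-1` [set k])))%E.
  under eq_integral do rewrite fimfunE -fsumEFin//.
  rewrite ge0_integral_fsum//; last 2 first.
  - by move=> k; exact/measurable_EFinP/measurable_funM.
  - by move=> k x _; rewrite nnfun_muleindic_ge0.
  apply: eq_fsbigr => k _; rewrite integralZl_indic_nnsfun// integral_indic//=.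
  by rewrite setIT.
transitivity (\sum_(k \in range (f_ n))
    \int[mu]_x ((k * \1_(f_ n @^-1` [set k]) x)%:E * (g x)%:E))%E.
  apply: eq_fsbigr => k; rewrite inE => -[x _ kE].
  have k0 : 0 <= k by rewrite -kE.
  under [RHS]eq_integral do rewrite EFinM -muleA.
  rewrite ge0_integralZl_EFin//.
  - congr (_ * _)%E; rewrite nuE//.
    rewrite integral_mkcond; apply: eq_integral => y _.
    by rewrite epatch_indic muleC.
  - by move=> y _; rewrite mule_ge0// lee_fin.
  - by apply: emeasurable_funM; exact/measurable_EFinP.
rewrite -ge0_integral_fsum//.
- apply: eq_integral => x _; rewrite [in RHS]fimfunE.
  rewrite -fsumEFin// ge0_mule_fsuml// => k; exact: nnfun_muleindic_ge0.
- move=> k; apply: emeasurable_funM; last exact/measurable_EFinP.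
  exact/measurable_EFinP/measurable_funM.
- move=> k x _; rewrite mule_ge0 ?lee_fin//.
  exact: nnfun_muleindic_ge0.
Qed.
(** Only simple functions below the integrand enter the integral of a
    nonnegative function, so that monotonicity is free of measurability.  It
    is applied to the loss of the estimator. *)
Lemma ge0_le_integral_nonmeasurable (R : realType) d (T : measurableType d)
    (mu : {measure set T -> \bar R}) (f g : T -> \bar R) :
    (forall x, (0 <= f x)%E) -> (forall x, (f x <= g x)%E) ->
  (\int[mu]_x f x <= \int[mu]_x g x)%E.
Proof.
move=> f0 fg; have g0 x : (0 <= g x)%E by exact: le_trans (f0 x) (fg x).
rewrite !ge0_integralTE//; apply: le_ereal_sup => _ [h hf <-].
by exists h => // x; apply: le_trans (fg x); exact: hf.
Qed.

Section real_integral.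
Local Open Scope ereal_scope.
Variables (R : realType) (d : measure_display) (T : measurableType d)
  (P : {measure set T -> \bar R}).

Lemma ge0_le_EFin_integral (f g : T -> R) :
    measurable_fun setT f -> measurable_fun setT g -> (forall w, 0 <= f w)%R ->
    (forall w, f w <= g w)%R ->
  \int[P]_w (f w)%:E <= \int[P]_w (g w)%:E.
Proof.
move=> mf mg f0 fg; apply: ge0_le_integral => //.
- by move=> w _; rewrite lee_fin.
- exact/measurable_EFinP.
- exact/measurable_EFinP.
- by move=> w _; rewrite lee_fin.
Qed.

Lemma ge0_integralD_EFin (f g : T -> R) :
    measurable_fun setT f -> measurable_fun setT g ->
    (forall w, 0 <= f w)%R -> (forall w, 0 <= g w)%R ->
  \int[P]_w (f w + g w)%:E = \int[P]_w (f w)%:E + \int[P]_w (g w)%:E.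
Proof.
move=> mf mg f0 g0; under eq_integral do rewrite EFinD.
by rewrite ge0_integralD//;
  [move=> w _; rewrite lee_fin|exact/measurable_EFinP|
   move=> w _; rewrite lee_fin|exact/measurable_EFinP].
Qed.

Lemma ge0_integralZ_EFin (k : R) (f : T -> R) : (0 <= k)%R ->
    measurable_fun setT f -> (forall w, 0 <= f w)%R ->
  \int[P]_w (k * f w)%:E = k%:E * \int[P]_w (f w)%:E.
Proof.
move=> k0 mf f0; under eq_integral do rewrite EFinM.
by rewrite ge0_integralZl_EFin//; [move=> w _; rewrite lee_fin|exact/measurable_EFinP].
Qed.

Lemma measurable_sum_cond (I : Type) (s : seq I) (p : pred I) (f : I -> T -> R) :
    (forall i, p i -> measurable_fun setT (f i)) ->
  measurable_fun setT (fun w => \sum_(i <- s | p i) f i w)%R.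
Proof.
move=> mf; elim: s => [|i s IH].
  by under eq_fun do rewrite big_nil; exact: measurable_cst.
under eq_fun do rewrite big_cons.
case: (p i) (mf i) => [mfi|_]; last exact: IH.
by apply: measurable_funD => //; exact: mfi.
Qed.

Lemma ge0_integral_sum_EFin (I : Type) (s : seq I) (p : pred I) (f : I -> T -> R) :
    (forall i, p i -> measurable_fun setT (f i)) -> (forall i w, 0 <= f i w)%R ->
  \int[P]_w (\sum_(i <- s | p i) f i w)%:E = \sum_(i <- s | p i) \int[P]_w (f i w)%:E.
Proof.
move=> mf f0; elim: s => [|i s IH].
  by under eq_integral do rewrite big_nil; rewrite integral0 big_nil.
under eq_integral do rewrite big_cons.
rewrite big_cons; case: (p i) (mf i) => [mfi|_]; last exact: IH.
rewrite ge0_integralD_EFin ?IH//; first last.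
- by move=> w; exact: sumr_ge0.
- exact: measurable_sum_cond.
- exact: mfi.
Qed.
End real_integral.

(** * Independence of one coordinate from the others *)

Section indep.
Variables (R : realType) (d : measure_display) (T : measurableType d)
  (P : probability T R).

(** The joint law of [(X, Z)] is the product of the marginal laws, because both
    agree on rectangles; then Tonelli's theorem separates the variables. *)
Lemma indep_integralM (X Z : T -> R) :
    measurable_fun setT X -> measurable_fun setT Z ->
    (forall w, 0 <= X w) -> (forall w, 0 <= Z w) ->
    (forall A B : set R, measurable A -> measurable B ->
      P (X @^-1` A `&` Z @^-1` B) = (P (X @^-1` A) * P (Z @^-1` B))%E) ->
  (\int[P]_w (X w * Z w)%:E = \int[P]_w (X w)%:E * \int[P]_w (Z w)%:E)%E.
Proof.
move=> mX mZ X0 Z0 XZ.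
pose X' : {mfun T >-> R} := HB.pack X (isMeasurableFun.Build _ _ _ _ _ mX).
pose Z' : {mfun T >-> R} := HB.pack Z (isMeasurableFun.Build _ _ _ _ _ mZ).
have mXZ : measurable_fun setT (fun w => (X w, Z w)).
  exact/measurable_fun_pair.
pose XZ' : {mfun T >-> (R * R)%type} := HB.pack (fun w => (X w, Z w))
  (isMeasurableFun.Build _ _ _ _ _ mXZ).
(* Truncating at 0 makes the product nonnegative on the whole plane. *)
pose f (p : R * R) : \bar R := (Num.max p.1 0 * Num.max p.2 0)%:E.
have mf : measurable_fun setT f.
  apply/measurable_EFinP; apply: measurable_funM;
    by apply: measurable_maxr.
have f0 p : (0 <= f p)%E by rewrite lee_fin mulr_ge0 // le_max lexx orbT.
have mm : measurable_fun setT (fun x : R => (Num.max x 0)%:E).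
  by apply/measurable_EFinP; apply: measurable_maxr.
have m0 (x : R) : (0 <= (Num.max x 0)%:E)%E by rewrite lee_fin le_max lexx orbT.
transitivity (\int[distribution P XZ']_p f p)%E.
  rewrite ge0_integral_distribution//.
  by apply: eq_integral => w _ /=; rewrite /f /= !max_l.
transitivity (\int[(distribution P X' \x distribution P Z')%E]_p f p)%E.
  apply: eq_measure_integral => A mA _; apply/esym.
  apply: product_measure_unique => //.
rewrite fubini_tonelli1//.
under eq_integral => x _.
  rewrite /fubini_F /f/=.
  under eq_integral do rewrite EFinM.
  rewrite ge0_integralZl_EFin//; last by rewrite le_max lexx orbT.
  over.
rewrite ge0_integralZr//=; last exact: integral_ge0.
congr (_ * _)%E; rewrite ge0_integral_distribution//.
  by apply: eq_integral => w _ /=; rewrite max_l.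
by apply: eq_integral => w _ /=; rewrite max_l.
Qed.

Variables (n : nat) (Y : 'I_n -> {RV P >-> R}).

(** Cylinders that leave the coordinate [i] unconstrained: a pi-system
    generating the sigma-algebra of the other coordinates. *)
Definition cylinders_off (i : 'I_n) : set (set T) :=
  [set A | exists B : 'I_n -> set R, [/\ forall j, measurable (B j), B i = setT
     & A = [set w | forall j, B j (Y j w)]]].

Lemma cylinders_off_sub i : cylinders_off i `<=` measurable.
Proof.
move=> _ [C [mC _ ->]].
rewrite (_ : mkset _ = \bigcap_(j in setT) (Y j @^-1` C j)).
  apply: fin_bigcap_measurable => // j _; exact: measurable_funPTI.
by apply/seteqP; split=> w /= h j; [move=> _; exact: h|exact: (h j I)].
Qed.

(** For fixed [B] both sides are finite measures in [A]; they agree on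
    cylinders by the product rule, hence on the generated sigma-algebra by
    Dynkin's lemma. *)
Lemma cylinders_offP i A B : mutually_independent Y ->
  <<s cylinders_off i >> A -> measurable B ->
  P (A `&` Y i @^-1` B) = (P A * P (Y i @^-1` B))%E.
Proof.
move=> indY sA mB.
have mYB : measurable (Y i @^-1` B) by exact: measurable_funPTI.
have fB : P (Y i @^-1` B) \is a fin_num by rewrite fin_num_measure.
have r0 : 0 <= fine (P (Y i @^-1` B)) by rewrite fine_ge0.
pose m1 := mrestr P mYB.
pose m2 := mscale (NngNum r0) P.
suff : m1 A = m2 A by rewrite /m1 /m2 /mscale/= fineK// muleC.
have cT : cylinders_off i setT.
  exists (fun=> setT); split => //; apply/seteqP; split=> w //=.
apply: (@g_sigma_algebra_measure_unique _ _ _ (cylinders_off i) (@cylinders_off_sub i)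
  (fun=> setT)) => //.
- by rewrite bigcup_const.
- move=> _ _ [C [mC Ci ->]] [D [mD Di ->]].
  exists (fun j => C j `&` D j); split.
  + by move=> j; exact: measurableI.
  + by rewrite Ci Di setIT.
  + apply/seteqP; split=> w /=; first by move=> [h1 h2] j; split.
    by move=> h; split=> j; have [] := h j.
- move=> _ [C [mC Ci ->]].
  change (P ([set w | forall j, C j (Y j w)] `&` Y i @^-1` B) =
    (fine (P (Y i @^-1` B)))%:E * P [set w | forall j, C j (Y j w)])%E.
  rewrite fineK//.
  pose D j := if j == i then B else C j.
  have mD j : measurable (D j) by rewrite /D; case: ifP.
  rewrite (_ : _ `&` _ = [set w | forall j, D j (Y j w)]).
    rewrite !indY// (bigD1 i)//= [in RHS](bigD1 i)//= Ci preimage_setT.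
    rewrite probability_setT mul1e /D eqxx; congr (_ * _)%E.
    by apply: eq_bigr => j /negPf ->.
  apply/seteqP; split=> w /=.
    by move=> [h hB] j; rewrite /D; case: eqP => [->|].
  move=> h; split=> [j|]; last by have := h i; rewrite /D eqxx.
  have := h j; rewrite /D; case: eqP => [->|//]; by rewrite Ci.
- move=> _; change (P (setT `&` Y i @^-1` B) < +oo)%E.
  by rewrite setTI ltey_eq fB.
Qed.

(** [g] is a function of the coordinates other than [i]. *)
Definition free_of (i : 'I_n) (g : T -> R) :=
  @measurable_fun _ _ (g_sigma_algebraType (cylinders_off i)) R setT g.

Lemma free_of_measurable i g : free_of i g -> measurable_fun setT g.
Proof.
move=> mg _ B mB.
have : <<s cylinders_off i >> `<=` measurable.
  by apply: smallest_sub; [exact: sigma_algebra_measurable|exact: cylinders_off_sub].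
by apply; exact: (mg measurableT B mB).
Qed.

Lemma free_of_coord i j : j != i -> free_of i (Y j).
Proof.
move=> ji _ B mB; apply: sub_sigma_algebra.
exists (fun k => if k == j then B else setT); split.
- by move=> k; case: ifP.
- by rewrite eq_sym (negPf ji).
- apply/seteqP; split=> w /=.
    by move=> [_ Bw] k; case: eqP => // ->.
  by move=> /(_ j); rewrite eqxx.
Qed.

Lemma free_of_integralM i (g : T -> R) (f : R -> R) : mutually_independent Y -> free_of i g ->
    measurable_fun setT f -> (forall w, 0 <= g w) -> (forall x, 0 <= f x) ->
  (\int[P]_w (g w * f (Y i w))%:E =
   \int[P]_w (g w)%:E * \int[P]_w (f (Y i w))%:E)%E.
Proof.
move=> indY mg mf g0 f0; apply: indep_integralM => //.
- exact: free_of_measurable mg.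
- exact: measurableT_comp.
- move=> A B mA mB.
  apply: (@cylinders_offP i (g @^-1` A) (f @^-1` B) indY).
    by have := mg measurableT A mA; rewrite setTI.
  by rewrite -[X in measurable X]setTI; exact: mf.
Qed.
End indep.

(** * Moments of the Gaussian noise *)

(** Completing the square: tilting the density by [expR (a * (x - m))] shifts
    its mean to [m + a * s ^+ 2], up to the constant on the right, and a normal
    density integrates to 1 whatever its mean. *)
Lemma normal_prob_mgf (R : realType) (m s a : R) : s != 0 ->
  (\int[normal_prob m s]_x (expR (a * (x - m)))%:E = (expR (a ^+ 2 * s ^+ 2 / 2))%:E)%E.
Proof.
move=> s0.
rewrite (@ge0_integral_density _ _ _ lebesgue_measure _ (normal_pdf m s))//; last 3 first.
- exact: measurable_normal_pdf.
- exact: normal_pdf_ge0.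
- apply/measurable_EFinP; apply: measurableT_comp => //.
  apply: measurable_funM => //; exact: measurable_funB.
transitivity (\int[lebesgue_measure]_x ((expR (a ^+ 2 * s ^+ 2 / 2))%:E
  * (normal_pdf (m + a * s ^+ 2) s x)%:E))%E.
  apply: eq_integral => x _; rewrite -!EFinM; congr EFin.
  rewrite !normal_pdfE// /normal_fun mulrCA -expRD mulrCA -expRD.
  congr (_ * expR _); field; exact: s0.
rewrite ge0_integralZl_EFin ?expR_ge0//.
- by rewrite integral_normal_pdf mule1.
- by move=> x _; rewrite lee_fin normal_pdf_ge0.
- by apply/measurable_EFinP; exact: measurable_normal_pdf.
Qed.

Lemma sqr_le_expR (R : realType) (x : R) : x ^+ 2 <= 4 * (expR x + expR (- x)).
Proof.
have H (y : R) : 0 <= y -> y ^+ 2 <= 4 * expR y.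
  move=> y0; have h := expR_ge1Dx (y / 2).
  rewrite {2}(splitr y) expRD.
  have := expR_gt0 (y / 2); nra.
have [x0|x0] := leP 0 x.
- have := H _ x0; have := expR_gt0 (- x); lra.
- have /H : 0 <= - x by lra.
  rewrite sqrrN; have := expR_gt0 x; lra.
Qed.

Lemma expR_half_le2 (R : realType) : expR (2^-1 : R) <= 2.
Proof.
have := expR_ge1Dx (- 2^-1 : R); rewrite expRN => h.
have e0 := expR_gt0 (2^-1 : R).
have := h; rewrite -(ler_pM2l e0) mulfV ?gt_eqF// => h2.
lra.
Qed.

(** Letting [t] tend to 0: the exponential is [1 + o(t)]. *)
Lemma le_of_small_expR (R : realType) (p q c : R) : 0 <= c ->
  (forall t, 0 < t -> 1 + t * p <= expR (c * t ^+ 2) + t * q) -> p <= q.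
Proof.
move=> c0 h; rewrite leNgt; apply/negP => qp.
(* With t = min(1, p - q) / (4c + 2), the exponent c t^2 is at most 1/2, where
   expR x <= 1 + 2x, and 2 c t^2 is at most t (p - q) / 2. *)
pose e := Num.min 1 (p - q).
have e1 : e <= 1 by rewrite ge_min lexx.
have e2 : e <= p - q by rewrite ge_min lexx orbT.
have e0 : 0 < e by rewrite lt_min ltr01 subr_gt0.
have c4 : 0 < 4 * c + 2 by lra.
pose t := e / (4 * c + 2).
have t0 : 0 < t by rewrite divr_gt0.
have tE : t * (4 * c + 2) = e by rewrite mulfVK ?gt_eqF.
have {h} := h _ t0; move: (t) t0 tE => {}t t0 tE h.
have x0 : 0 <= c * t ^+ 2 by rewrite mulr_ge0// sqr_ge0.
have x1 : c * t ^+ 2 <= 2^-1 by nra.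
have [x xE] : exists x, x = c * t ^+ 2 by exists (c * t ^+ 2).
rewrite -xE in x0 x1 h.
have hx := expR_ge1Dx (- x); have ex0 := expR_gt0 x.
rewrite expRN in hx.
have h1 := hx; rewrite -(ler_pM2l ex0) mulfV ?gt_eqF// in h1.
have : expR x <= 1 + 2 * x by nra.
nra.
Qed.

Section gauss.
Variables (R : realType) (d : measure_display) (T : measurableType d)
  (P : probability T R) (n : nat) (Y : 'I_n -> {RV P >-> R})
  (theta : 'rV[R]_n) (sigma : R).
Hypotheses (s0 : 0 < sigma) (gY : gaussian_vector Y theta sigma).

Definition noise (i : 'I_n) (w : T) : R := Y i w - theta 0 i.

Lemma measurable_noise i : measurable_fun setT (noise i).
Proof. exact: measurable_funB. Qed.

Lemma noise_mgf1 i a :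
  (\int[P]_w (expR (a * noise i w))%:E = (expR (a ^+ 2 * sigma ^+ 2 / 2))%:E)%E.
Proof.
rewrite -(@normal_prob_mgf _ (theta 0 i)) ?gt_eqF//.
(* The normal law is a measure on another copy of the Borel line, with the
   same measurable sets. *)
have mY : measurable_fun setT (Y i : T -> measurableTypeR R).
  by move=> _ B mB; rewrite setTI; exact: measurable_funPTI.
transitivity (\int[pushforward P (Y i : T -> measurableTypeR R)]_x
    (expR (a * (x - theta 0 i)))%:E)%E.
  rewrite ge0_integral_pushforward//.
  - apply/measurable_EFinP; apply: measurableT_comp => //.
    apply: measurable_funM => //; exact: measurable_funB.
by apply: eq_measure_integral => A mA _; exact: (gY.1 i A mA).
Qed.

Lemma free_of_noise i j : j != i -> free_of Y i (noise j).
Proof. by move=> ji; apply: measurable_funB => //; exact: free_of_coord. Qed.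

Lemma free_of_sum i (a : 'I_n -> R) (s : seq 'I_n) : i \notin s ->
  free_of Y i (fun w => \sum_(j <- s) a j * noise j w).
Proof.
rewrite /free_of; elim: s => [_|j s IH].
  by under eq_fun do rewrite big_nil; exact: measurable_cst.
rewrite inE negb_or => /andP[ij /IH fs].
under eq_fun do rewrite big_cons.
apply: measurable_funD => //; apply: measurable_funM => //.
by apply: free_of_noise; rewrite eq_sym.
Qed.

(** Each factor is split off by [free_of_integralM]. *)
Lemma noise_mgf_seq (a : 'I_n -> R) (s : seq 'I_n) : uniq s ->
  (\int[P]_w (expR (\sum_(i <- s) a i * noise i w))%:E =
   (expR ((\sum_(i <- s) a i ^+ 2) * sigma ^+ 2 / 2))%:E)%E.
Proof.
elim: s => [_|i s IH /= /andP[nis us]].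
  under eq_integral do rewrite big_nil.
  by rewrite big_nil !mul0r expR0 integral_cst//= probability_setT mul1e.
under eq_integral do rewrite big_cons addrC expRD.
have fr : free_of Y i (fun w => expR (\sum_(j <- s) a j * noise j w)).
  by apply: measurableT_comp => //; exact: free_of_sum.
rewrite (@free_of_integralM _ _ _ _ _ Y i (fun w => expR (\sum_(j <- s) a j * noise j w))
  (fun x => expR (a i * (x - theta 0 i))))//; first last.
- apply: measurableT_comp => //.
  apply: measurable_funM => //; exact: measurable_funB.
- by case: gY.
rewrite IH// noise_mgf1 -EFinM -expRD big_cons; congr (expR _)%:E.
by rewrite -!mulrDl addrC.
Qed.

Lemma noise_mgf (a : 'I_n -> R) :
  (\int[P]_w (expR (\sum_i a i * noise i w))%:E =
   (expR ((\sum_i a i ^+ 2) * sigma ^+ 2 / 2))%:E)%E.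
Proof. exact: (noise_mgf_seq a (index_enum_uniq 'I_n)). Qed.

(** [sqr_le_expR] at [x = noise / sigma] reduces the second moment to the
    moment generating function. *)
Lemma noise_sqr i : (\int[P]_w (noise i w ^+ 2)%:E <= (16 * sigma ^+ 2)%:E)%E.
Proof.
apply: (@le_trans _ _ (\int[P]_w
  ((4 * sigma ^+ 2)%:E * ((expR (sigma^-1 * noise i w))%:E + (expR (- sigma^-1 * noise i w))%:E)))%E).
  apply: ge0_le_integral => //.
  - by move=> w _; rewrite lee_fin sqr_ge0.
  - by apply/measurable_EFinP; apply: measurable_funX; exact: measurable_noise.
  - apply: measurable_funeM; apply: emeasurable_funD; apply/measurable_EFinP;
    apply: measurableT_comp => //; apply: measurable_funM => //; exact: measurable_noise.
  - move=> w _; rewrite -EFinD -EFinM lee_fin.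
    have := sqr_le_expR (sigma^-1 * noise i w).
    rewrite exprMn -mulNr -[leLHS]mulrC -ler_pdivlMr ?exprn_gt0 ?invr_gt0//.
    rewrite exprVn invrK => h; rewrite (le_trans h)//. by rewrite mulrAC.
have mE b : measurable_fun setT (fun w => (expR (b * noise i w))%:E).
  apply/measurable_EFinP; apply: measurableT_comp => //.
  by apply: measurable_funM => //; exact: measurable_noise.
have s20 : 0 <= 4 * sigma ^+ 2 by rewrite mulr_ge0 ?sqr_ge0.
rewrite ge0_integralZl_EFin//; last 2 first.
- by move=> w _; rewrite adde_ge0 ?lee_fin ?expR_ge0.
- exact: emeasurable_funD.
rewrite ge0_integralD//.
rewrite !noise_mgf1 -EFinD -EFinM lee_fin sqrrN.
rewrite exprVn mulVf ?expf_neq0 ?gt_eqF// mul1r.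
have := expR_half_le2 R; have := sqr_ge0 sigma; nra.
Qed.

(** The noise is centred.  Stated for the positive and negative parts, it needs
    nonnegative integrals only; integrating [1 + t x <= expR (t x)] and using
    [le_of_small_expR] in both directions gives the equality. *)
Lemma noise_posneg i :
  exists2 k : R, 0 <= k &
  (\int[P]_w (Num.max (noise i w) 0)%:E = k%:E /\
   \int[P]_w (Num.max (- noise i w) 0)%:E = k%:E)%E.
Proof.
have mN := measurable_noise i.
pose f (b : R) w := Num.max (b * noise i w) 0.
have mbN b : measurable_fun setT (fun w => b * noise i w) by exact: measurable_funM.
have mf b : measurable_fun setT (fun w => (f b w)%:E).
  by apply/measurable_EFinP; apply: measurable_maxr.
have f0 b w : 0 <= f b w by rewrite le_max lexx orbT.
have me b : measurable_fun setT (fun w => (expR (b * noise i w))%:E).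
  by apply/measurable_EFinP; apply: measurableT_comp.
have E0 b : (0 <= \int[P]_w (f b w)%:E)%E.
  by apply: integral_ge0 => w _; rewrite lee_fin.
have fin b : (\int[P]_w (f b w)%:E)%E \is a fin_num.
  rewrite ge0_fin_numE//.
  apply: (@le_lt_trans _ _ (\int[P]_w (expR (b * noise i w))%:E)%E).
    apply: ge0_le_integral => //; first by move=> w _; rewrite lee_fin.
    move=> w _; rewrite lee_fin ge_max expR_ge0 andbT.
    by have := expR_ge1Dx (b * noise i w); lra.
  by rewrite noise_mgf1 ltry.
have main b : b ^+ 2 = 1 ->
    (\int[P]_w (f b w)%:E <= \int[P]_w (f (- b) w)%:E)%E.
  move=> b2; rewrite -(fineK (fin b)) -(fineK (fin (- b))) lee_fin.
  apply: (@le_of_small_expR _ _ _ (sigma ^+ 2 / 2)); first by rewrite divr_ge0 ?sqr_ge0.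
  move=> t t0; rewrite -lee_fin !EFinD !EFinM !fineK//.
  have -> : (expR (sigma ^+ 2 / 2 * t ^+ 2))%:E = (\int[P]_w (expR (t * b * noise i w))%:E)%E.
    by rewrite noise_mgf1 exprMn b2; congr (expR _)%:E; ring.
  have t1 := ltW t0; rewrite -!ge0_integralZl_EFin//; try by move=> w _; rewrite lee_fin.
  have -> : 1%:E = (\int[P]_w (cst 1%:E w))%E.
    by rewrite integral_cst//= probability_setT mul1e.
  rewrite -!ge0_integralD//; try (by apply: measurable_funeM); try
    (by move=> w _; rewrite -?EFinM lee_fin ?expR_ge0// mulr_ge0// ltW).
  apply: ge0_le_integral => //.
  - by move=> w _; rewrite adde_ge0 ?lee_fin// mulr_ge0// ltW.
  - by apply: emeasurable_funD => //; apply: measurable_funeM.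
  - by apply: emeasurable_funD => //; apply: measurable_funeM.
  - move=> w _; rewrite /= -!EFinM -!EFinD lee_fin /f.
    have := expR_ge1Dx (t * b * noise i w).
    have [h|h] := leP 0 (b * noise i w).
      rewrite [Num.max (- b * _) _]max_r; last by rewrite mulNr oppr_le0.
      by rewrite mulr0 addr0 mulrA.
    rewrite [Num.max (- b * _) _]max_l; last by rewrite mulNr oppr_ge0 ltW.
    by rewrite -mulrA => h2; rewrite mulr0; lra.
exists (fine (\int[P]_w (f 1 w)%:E)%E); first exact: fine_ge0.
have E1 : (\int[P]_w (f 1 w)%:E = \int[P]_w (f (-1) w)%:E)%E.
  apply/eqP; rewrite eq_le main ?expr1n//=.
  by have := main (-1); rewrite opprK sqrrN expr1n; apply.
rewrite fineK//; split; last rewrite E1; by apply: eq_integral => w _; rewrite /f ?mul1r ?mulN1r.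
Qed.
End gauss.

(** * A maximal inequality *)

Section running_max.
Variable R : realType.
Implicit Types z : nat -> R.

Definition psum z t : R := \sum_(i < t) z i.

Fixpoint rmax z t : R :=
  if t is s.+1 then Num.max (rmax z s) (psum z t) else 0.

Lemma psum0 z : psum z 0 = 0. Proof. by rewrite /psum big_ord0. Qed.

Lemma psumS z t : psum z t.+1 = psum z t + z t.
Proof. by rewrite /psum big_ord_recr. Qed.

Lemma rmax_ge0 z t : 0 <= rmax z t.
Proof. by elim: t => //= t IH; rewrite le_max IH. Qed.

Lemma rmax_nondecreasing z s t : (s <= t)%N -> rmax z s <= rmax z t.
Proof.
elim: t => [|t IH]; first by rewrite leqn0 => /eqP ->.
rewrite leq_eqVlt => /predU1P[-> //|]; rewrite ltnS => /IH h.
by rewrite /= le_max h.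
Qed.

Lemma psum_le_rmax z s t : (s <= t)%N -> psum z s <= rmax z t.
Proof.
move=> /(rmax_nondecreasing z); apply: le_trans.
by case: s => [|s]; [rewrite psum0 | rewrite /= le_max lexx orbT].
Qed.

Lemma norm_psum_le z t : `|psum z t| <= \sum_(i < t) `|z i|.
Proof. exact: ler_norm_sum. Qed.

Lemma rmax_le_sum_norm z t : rmax z t <= \sum_(i < t) `|z i|.
Proof.
elim: t => [|t IH] /=; first by rewrite big_ord0.
rewrite ge_max (le_trans (ler_norm _) (norm_psum_le z t.+1)) andbT.
by rewrite big_ord_recr (le_trans IH)// lerDl.
Qed.

(** Pathwise form of Doob's inequality in L2.  The running maximum M grows only
    at times when it equals the partial sum S; summation by parts then gives
    sum_i M_i z_i <= M_t S_t - M_t^2 / 2, while S_t^2 expands as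
    sum_i z_i^2 + 2 sum_i S_i z_i.  In the last sum of the conclusion each [z i]
    is multiplied by a function of the previous ones. *)
Lemma sqr_rmax_le z t : rmax z t ^+ 2 <=
  4 * (\sum_(i < t) z i ^+ 2) + 4 * \sum_(i < t) (2 * psum z i - rmax z i) * z i.
Proof.
have sqS : psum z t ^+ 2 = \sum_(i < t) z i ^+ 2 + 2 * \sum_(i < t) psum z i * z i.
  elim: t => [|t IH]; first by rewrite psum0 !big_ord0 mulr0 addr0 expr0n.
  by rewrite psumS !big_ord_recr/= sqrrD IH; ring.
have sqM : \sum_(i < t) rmax z i * z i <= rmax z t * psum z t - rmax z t ^+ 2 / 2.
  elim: t {sqS} => [|t IH]; first by rewrite big_ord0 /= mul0r expr0n/= mul0r subr0.
  rewrite big_ord_recr; apply: (le_trans (lerD IH (lexx _))) => /=.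
  rewrite psumS; have [h|h] := leP (psum z t + z t) (rmax z t); first by lra.
  have := sqr_ge0 (psum z t + z t - rmax z t); nra.
have -> : \sum_(i < t) (2 * psum z i - rmax z i) * z i =
    2 * (\sum_(i < t) psum z i * z i) - \sum_(i < t) rmax z i * z i.
  by rewrite mulr_sumr -sumrB; apply: eq_bigr => i _; ring.
have := sqr_ge0 (rmax z t - 2 * psum z t); nra.
Qed.
Lemma measurable_psum_rmax d (T : measurableType d) (z : T -> nat -> R) t :
    (forall s, (s < t)%N -> measurable_fun setT (z^~ s)) ->
  measurable_fun setT (fun w => psum (z w) t) /\
  measurable_fun setT (fun w => rmax (z w) t).
Proof.
elim: t => [_|t IH mz].
  by split; first (under eq_fun do rewrite psum0); exact: measurable_cst.
have [s st|mS mM] := IH; first by apply: mz; rewrite ltnS ltnW.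
have mS' : measurable_fun setT (fun w => psum (z w) t.+1).
  by under eq_fun do rewrite psumS; apply: measurable_funD => //; exact: mz.
by split=> //=; exact: measurable_maxr.
Qed.
End running_max.

Section gauss_max.
Variables (R : realType) (d : measure_display) (T : measurableType d)
  (P : probability T R) (n : nat) (Y : 'I_n -> {RV P >-> R})
  (theta : 'rV[R]_n) (sigma : R).
Hypotheses (s0 : 0 < sigma) (gY : gaussian_vector Y theta sigma).
Local Notation noise := (noise Y theta).

(** E[g noise_i] = 0 for [g] free of [i], with negative terms moved to the other
    side so that no integrability is needed. *)
Lemma free_noise_cancel i (g : T -> R) : free_of Y i g ->
  (\int[P]_w (Num.max (g w) 0 * Num.max (noise i w) 0 +
              Num.max (- g w) 0 * Num.max (- noise i w) 0)%:E =
   \int[P]_w (Num.max (g w) 0 * Num.max (- noise i w) 0 +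
              Num.max (- g w) 0 * Num.max (noise i w) 0)%:E)%E.
Proof.
move=> fg; have [k k0 [Ep En]] := noise_posneg s0 gY i.
have m0 (x : R) : 0 <= Num.max x 0 by rewrite le_max lexx orbT.
have fgp : free_of Y i (fun w => Num.max (g w) 0) by exact: measurable_maxr.
have fgn : free_of Y i (fun w => Num.max (- g w) 0).
  by apply: measurable_maxr => //; exact: measurableT_comp.
have mp : measurable_fun setT (fun x : R => Num.max (x - theta 0 i) 0).
  by apply: measurable_maxr => //; exact: measurable_funB.
have mn : measurable_fun setT (fun x : R => Num.max (- (x - theta 0 i)) 0).
  by apply: measurable_maxr => //; apply: measurableT_comp => //; exact: measurable_funB.
have mY (f : R -> R) : measurable_fun setT f -> measurable_fun setT (fun w => f (Y i w)).
  by move=> mf; exact: measurableT_comp.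
have mgp := free_of_measurable fgp; have mgn := free_of_measurable fgn.
have iY : mutually_independent Y by case: gY.
have prod_int (h : T -> R) (f : R -> R) : free_of Y i h -> measurable_fun setT f ->
    (forall w, 0 <= h w) -> (forall x, 0 <= f x) ->
    (\int[P]_w (f (Y i w))%:E = k%:E)%E ->
    (\int[P]_w (h w * f (Y i w))%:E = \int[P]_w (h w)%:E * k%:E)%E.
  by move=> fh mf h0 f0 fk; rewrite (free_of_integralM iY)// fk.
have split_int (h1 h2 : T -> R) : measurable_fun setT h1 -> measurable_fun setT h2 ->
    (forall w, 0 <= h1 w) -> (forall w, 0 <= h2 w) ->
    (\int[P]_w (h1 w + h2 w)%:E = \int[P]_w (h1 w)%:E + \int[P]_w (h2 w)%:E)%E.
  move=> mh1 mh2 h10 h20; under eq_integral do rewrite EFinD.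
  by rewrite ge0_integralD//; [move=> w _; rewrite lee_fin|exact/measurable_EFinP|
    move=> w _; rewrite lee_fin|exact/measurable_EFinP].
have mNp := mY _ mp; have mNn := mY _ mn.
rewrite !split_int//; try (by move=> w; rewrite mulr_ge0); try exact: measurable_funM.
rewrite (prod_int _ (fun x => Num.max (x - theta 0 i) 0) fgp)//.
rewrite (prod_int _ (fun x => Num.max (- (x - theta 0 i)) 0) fgn)//.
rewrite (prod_int _ (fun x => Num.max (- (x - theta 0 i)) 0) fgp)//.
by rewrite (prod_int _ (fun x => Num.max (x - theta 0 i) 0) fgn).
Qed.

Lemma free_of_psum_rmax i (c : R) (p : nat -> 'I_n) t :
    (forall s, (s < t)%N -> p s != i) ->
  free_of Y i (fun w => psum (fun s => c * noise (p s) w) t) /\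
  free_of Y i (fun w => rmax (fun s => c * noise (p s) w) t).
Proof.
move=> pi; apply: measurable_psum_rmax => s st.
by apply: measurable_funM => //; apply: free_of_noise; exact: pi.
Qed.

(** The expectation of [sqr_rmax_le]: the cross terms cancel by
    [free_noise_cancel].  The injective [p] and the sign [c] allow partial sums
    that start anywhere, run in either direction, and change sign. *)
Lemma noise_rmax_sqr (c : R) (p : nat -> 'I_n) t : c ^+ 2 = 1 ->
    (forall r s, (r < s < t)%N -> p r != p s) ->
  (\int[P]_w (rmax (fun s => c * noise (p s) w) t ^+ 2)%:E
    <= (64 * t%:R * sigma ^+ 2)%:E)%E.
Proof.
move=> c2 pinj.
pose z w s := c * noise (p s) w.
pose g s w := c * (2 * psum (z w) s - rmax (z w) s).
have fSM s : (s < t)%N -> free_of Y (p s) (fun w => psum (z w) s) /\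
    free_of Y (p s) (fun w => rmax (z w) s).
  by move=> st; apply: free_of_psum_rmax => r rs; apply: pinj; rewrite rs.
have fg s : (s < t)%N -> free_of Y (p s) (g s).
  move=> st; have [fS fM] := fSM _ st.
  by apply: measurable_funM => //; apply: measurable_funB => //; exact: measurable_funM.
have [_ mM] : measurable_fun setT (fun w => psum (z w) t) /\
   measurable_fun setT (fun w => rmax (z w) t).
  apply: measurable_psum_rmax => s _.
  by apply: measurable_funM => //; exact: measurable_noise.
have c1 : `|c| = 1 by apply/eqP; rewrite -sqrp_eq1// -normrX c2 normr1.
(* [a s - b s] is the cross term of index [s], split into nonnegative parts. *)
pose a s w := Num.max (g s w) 0 * Num.max (noise (p s) w) 0 +
              Num.max (- g s w) 0 * Num.max (- noise (p s) w) 0.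
pose b s w := Num.max (g s w) 0 * Num.max (- noise (p s) w) 0 +
              Num.max (- g s w) 0 * Num.max (noise (p s) w) 0.
have m0 (x : R) : 0 <= Num.max x 0 by rewrite le_max lexx orbT.
have a0 s w : 0 <= a s w by rewrite addr_ge0 ?mulr_ge0.
have b0 s w : 0 <= b s w by rewrite addr_ge0 ?mulr_ge0.
have norm_pn (x : R) : `|x| = Num.max x 0 + Num.max (- x) 0.
  have [h|h] := leP 0 x; first by rewrite max_r ?addr0 ?oppr_le0// ger0_norm.
  by rewrite max_l ?add0r ?oppr_ge0 ?ltr0_norm// ltW.
have ab s w : a s w - b s w = g s w * noise (p s) w.
  have pn (x : R) : x = Num.max x 0 - Num.max (- x) 0.
    have [h|h] := leP 0 x; first by rewrite max_r ?subr0 ?oppr_le0.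
    by rewrite max_l ?sub0r ?opprK ?oppr_ge0// ltW.
  by rewrite [g s w in RHS]pn [noise _ _ in RHS]pn /a /b; ring.
have main w : rmax (z w) t ^+ 2 + 4 * \sum_(s < t) b s w <=
    4 * (\sum_(s < t) noise (p s) w ^+ 2) + 4 * \sum_(s < t) a s w.
  have := sqr_rmax_le (z w) t.
  have -> : \sum_(i < t) z w i ^+ 2 = \sum_(s < t) noise (p s) w ^+ 2.
    by apply: eq_bigr => s _; rewrite exprMn c2 mul1r.
  have -> : \sum_(i < t) (2 * psum (z w) i - rmax (z w) i) * z w i =
      \sum_(s < t) a s w - \sum_(s < t) b s w.
    by rewrite -sumrB; apply: eq_bigr => s _; rewrite ab /g /z; ring.
  lra.
have mN2 s : measurable_fun setT (fun w => noise (p s) w ^+ 2).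
  by apply: measurable_funX; exact: measurable_noise.
have mg s : (s < t)%N -> measurable_fun setT (g s) by move=> /fg/free_of_measurable.
have mmax (f : T -> R) : measurable_fun setT f -> measurable_fun setT (fun w => Num.max (f w) 0).
  by move=> mf; exact: measurable_maxr.
have mopp (f : T -> R) : measurable_fun setT f -> measurable_fun setT (fun w => - f w).
  by move=> mf; exact: measurableT_comp.
have mN s := measurable_noise Y theta (p s).
have ma s : (s < t)%N -> measurable_fun setT (a s).
  move=> /mg mgs; apply: measurable_funD; apply: measurable_funM; apply: mmax => //; exact: mopp.
have mb s : (s < t)%N -> measurable_fun setT (b s).
  move=> /mg mgs; apply: measurable_funD; apply: measurable_funM; apply: mmax => //; exact: mopp.
have sq0 (x : R) : 0 <= x ^+ 2 by exact: sqr_ge0.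
(* The cross terms must have a finite mean to be cancelled. *)
have b_le s w : b s w <= \sum_(i < s) (3 * (noise (p i) w ^+ 2 + noise (p s) w ^+ 2)).
  have gs : `|g s w| <= 3 * \sum_(i < s) `|noise (p i) w|.
    rewrite /g normrM c1.
    have := norm_psum_le (z w) s; have := rmax_le_sum_norm (z w) s.
    have := rmax_ge0 (z w) s.
    rewrite mul1r.
    have -> : \sum_(i < s) `|z w i| = \sum_(i < s) `|noise (p i) w|.
      apply: eq_bigr => i _; by rewrite /z normrM c1 mul1r.
    rewrite !ler_norml => h1 h2 /andP[h3 h4]; apply/andP; split; lra.
  have bg : b s w <= `|g s w| * `|noise (p s) w|.
    rewrite !norm_pn /b.
    have := mulr_ge0 (m0 (g s w)) (m0 (noise (p s) w)).
    have := mulr_ge0 (m0 (- g s w)) (m0 (- noise (p s) w)).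
    nra.
  apply: (le_trans bg); apply: (le_trans (ler_wpM2r (normr_ge0 _) gs)).
  rewrite -mulr_sumr -mulrA ler_wpM2l// mulr_suml; apply: ler_sum => i _.
  rewrite -(real_normK (num_real (noise (p i) w))) -(real_normK (num_real (noise (p s) w))).
  have := sqr_ge0 (`|noise (p i) w| - `|noise (p s) w|). 
  have := sqr_ge0 (`|noise (p i) w| + `|noise (p s) w|). nra.
have N2fin s : (\int[P]_w (noise (p s) w ^+ 2)%:E < +oo)%E.
  by apply: (le_lt_trans (noise_sqr s0 gY (p s))); rewrite ltry.
have bfin s : (s < t)%N -> (\int[P]_w (b s w)%:E < +oo)%E.
  move=> st; apply: (le_lt_trans (ge0_le_EFin_integral P (mb _ st) _ (b0 s) (b_le s))).
    by apply: measurable_sum_cond => i _; apply: measurable_funM => //; exact: measurable_funD.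
  rewrite ge0_integral_sum_EFin//; first last.
  - by move=> i w; rewrite mulr_ge0// addr_ge0.
  - by move=> i _; apply: measurable_funM => //; exact: measurable_funD.
  apply: lte_sum_pinfty => i _; rewrite ge0_integralZ_EFin//; first last.
  - by move=> w; rewrite addr_ge0.
  - exact: measurable_funD.
  have I0 (f : T -> R) : (forall w, 0 <= f w) -> (0 <= \int[P]_w (f w)%:E)%E.
    by move=> f0; apply: integral_ge0 => w _; rewrite lee_fin.
  rewrite ge0_integralD_EFin//; apply: lte_mul_pinfty => //.
  by apply: lte_add_pinfty.
have Iab s : (s < t)%N -> (\int[P]_w (a s w)%:E = \int[P]_w (b s w)%:E)%E.
  by move=> st; apply: (free_noise_cancel (fg _ st)).
have mSb : measurable_fun setT (fun w => \sum_(s < t) b s w).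
  by apply: measurable_sum_cond => s _; exact: mb.
have mSa : measurable_fun setT (fun w => \sum_(s < t) a s w).
  by apply: measurable_sum_cond => s _; exact: ma.
have mSN : measurable_fun setT (fun w => \sum_(s < t) noise (p s) w ^+ 2).
  by apply: measurable_sum_cond => s _.
have mR : measurable_fun setT (fun w => rmax (z w) t ^+ 2).
  exact: measurable_funX.
have Sb0 w : 0 <= \sum_(s < t) b s w by exact: sumr_ge0.
have Sa0 w : 0 <= \sum_(s < t) a s w by exact: sumr_ge0.
have SN0 w : 0 <= \sum_(s < t) noise (p s) w ^+ 2 by exact: sumr_ge0.
have K : (\int[P]_w (\sum_(s < t) b s w)%:E)%E \is a fin_num.
  rewrite ge0_fin_numE; last by apply: integral_ge0 => w _; rewrite lee_fin.
  rewrite ge0_integral_sum_EFin//.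
  - by apply: lte_sum_pinfty => s _; exact: bfin.
  - by move=> s _; exact: mb.
have -> : (64 * t%:R * sigma ^+ 2)%:E = (4%:E * \sum_(s < t) (16 * sigma ^+ 2)%:E)%E.
  rewrite sumEFin sumr_const card_ord -EFinM -mulr_natr; congr EFin; ring.
have K4 : (4%:E * \int[P]_w (\sum_(s < t) b s w)%:E)%E \is a fin_num.
  by rewrite fin_numM.
rewrite -(leeD2rE _ _ K4).
apply: (@le_trans _ _ (\int[P]_w (rmax (z w) t ^+ 2 + 4 * \sum_(s < t) b s w)%:E)%E).
  rewrite ge0_integralD_EFin//.
  - by rewrite ge0_integralZ_EFin.
  - exact: measurable_funM.
  - by move=> w; rewrite mulr_ge0.
apply: (@le_trans _ _ (\int[P]_w (4 * (\sum_(s < t) noise (p s) w ^+ 2)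
    + 4 * \sum_(s < t) a s w)%:E)%E).
  apply: ge0_le_EFin_integral => //.
  - by apply: measurable_funD => //; exact: measurable_funM.
  - by apply: measurable_funD => //; exact: measurable_funM.
  - by move=> w; rewrite addr_ge0 ?sq0// mulr_ge0.
rewrite ge0_integralD_EFin; first last.
- by move=> w; rewrite mulr_ge0.
- by move=> w; rewrite mulr_ge0.
- exact: measurable_funM.
- exact: measurable_funM.
rewrite !ge0_integralZ_EFin//; apply: leeD.
- rewrite lee_wpmul2l ?lee_fin// ge0_integral_sum_EFin//.
  by apply: lee_sum => s _; exact: noise_sqr.
- rewrite lee_wpmul2l ?lee_fin// !ge0_integral_sum_EFin//.
  + by apply: lee_sum => s _; rewrite Iab.
  + by move=> s _; exact: mb.
  + by move=> s _; exact: ma.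
Qed.
End gauss_max.

(** * A dual path on one block *)

Section block.
Variable R : realType.
Implicit Types (z y S e : nat -> R).

Lemma rmax_attained z t : exists2 s, (s <= t)%N & rmax z t = psum z s.
Proof.
elim: t => [|t [s st IH]]; first by exists 0%N => //; rewrite psum0.
rewrite /= -/(rmax z t); have [h|h] := leP (psum z t.+1) (rmax z t).
  by exists s => //; exact: leq_trans st _.
by exists t.+1.
Qed.

(** [M] interpolates linearly between the values [e k] at the times [2 ^ k].  It
    stays below [S] because [e k] is below [S] up to time [2 ^ k.+1], and the
    step from [2 ^ k] to [2 ^ k.+1] costs (e k.+1 - e k)^2 / 2^k, at most
    (e k.+1)^2 / 2^k since [e] is nonpositive and nonincreasing. *)
Lemma dyadic_path S e : S 0%N = 0 -> (forall q, e q.+1 <= e q) ->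
    (forall q, e q <= 0) -> (forall q i, (i <= 2 ^ q.+1)%N -> e q <= S i) ->
  forall k, exists M : nat -> R, [/\ M 0%N = 0, M (2 ^ k)%N = e k,
    forall i, (i <= 2 ^ k)%N -> e k <= M i <= S i &
    \sum_(i < 2 ^ k) (M i.+1 - M i) ^+ 2 <= \sum_(q < k.+1) 2 * e q ^+ 2 / 2 ^+ q].
Proof.
move=> S0 eS e0 eleS; elim=> [|k [M [M0 Mk MS cM]]].
  exists (fun i => if i is 0%N then 0 else e 0%N); split => //.
  - move=> [|[|i]]//= _; first by rewrite e0 S0 lexx.
    by rewrite lexx eleS.
  - rewrite expn0 !big_ord_recr !big_ord0 /= !add0r subr0 expr0 divr1.
    have := sqr_ge0 (e 0%N); lra.
have k0 : 0 < (2 ^ k)%:R :> R by rewrite ltr0n expn_gt0.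
pose D := (e k.+1 - e k) / (2 ^ k)%:R.
have De : D * (2 ^ k)%:R = e k.+1 - e k by rewrite mulfVK ?gt_eqF.
have D0 : D <= 0 by rewrite pmulr_lle0 ?invr_gt0// subr_le0.
pose M' i := if (i <= 2 ^ k)%N then M i else e k + D * (i - 2 ^ k)%:R.
have M'E i : (2 ^ k <= i)%N -> M' i = e k + D * (i - 2 ^ k)%:R.
  rewrite /M' leq_eqVlt => /predU1P[<-|h]; last by rewrite leqNgt h.
  by rewrite leqnn subnn mulr0 addr0.
have E2 : (2 ^ k.+1 = 2 ^ k + 2 ^ k)%N by rewrite expnS mul2n addnn.
exists M'; split.
- by rewrite /M' leq0n.
- by rewrite M'E ?E2 ?leq_addr// addnK De; ring.
- move=> i ik; have [h|h] := leqP i (2 ^ k)%N.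
    rewrite /M' h; have /andP[h1 ->] := MS _ h.
    by rewrite (le_trans (eS k))//.
  rewrite M'E ?(ltnW h)//.
  have i2 : (i - 2 ^ k)%:R <= (2 ^ k)%:R :> R by rewrite ler_nat; lia.
  have i0 : 0 <= (i - 2 ^ k)%:R :> R by [].
  have h2 := eleS k i ik; apply/andP; split; nra.
- rewrite E2 big_split_ord /= big_ord_recr/= lerD//.
    apply: le_trans cM; apply: ler_sum => i _; rewrite /M' /= (ltnW (ltn_ord i)).
    by rewrite ltn_ord.
  under eq_bigr => i _.
    rewrite !M'E; [|by rewrite leq_addr|by rewrite -addnS leq_addr].
    rewrite -addnS !addKn (_ : _ - _ = D); last by rewrite -natr1; ring.
    over.
  rewrite sumr_const card_ord.
  have natE : (2 ^ k)%:R = 2 ^+ k :> R by rewrite natrX.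
  rewrite -[_ *+ _]mulr_natr /D !natE exprMn [2 ^+ k.+1]exprS.
  have x0 : 0 < 2 ^+ k :> R by rewrite exprn_gt0.
  have -> : (e k.+1 - e k) ^+ 2 * (2 ^+ k)^-1 ^+ 2 * 2 ^+ k = (e k.+1 - e k) ^+ 2 / 2 ^+ k.
    by field; exact: lt0r_neq0.
  have -> : 2 * e k.+1 ^+ 2 / (2 * 2 ^+ k) = e k.+1 ^+ 2 / 2 ^+ k.
    by field; exact: lt0r_neq0.
  rewrite ler_pM2r ?invr_gt0//.
  have := eS k; have := e0 k; nra.
Qed.

(** Reading a block backwards: the partial sums of [rev_seq L y] at time [t] are
    S_L - S_(L - t), so its running maximum bounds S from below near the right
    end. *)
Definition rev_seq L y : nat -> R := fun s => y (L.-1 - s)%N.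
Definition neg_seq y : nat -> R := fun s => - y s.

Lemma psum_neg y t : psum (neg_seq y) t = - psum y t.
Proof. by rewrite /psum sumrN. Qed.

Lemma psum_rev L y t : (t <= L)%N -> psum (rev_seq L y) t = psum y L - psum y (L - t).
Proof.
elim: t => [|t IH] tL; first by rewrite psum0 subn0 subrr.
rewrite psumS IH; last exact: ltnW.
have -> : (L - t = (L - t.+1).+1)%N by lia.
have E : (L.-1 - t = L - t.+1)%N by lia.
by rewrite psumS /rev_seq E; ring.
Qed.

Lemma rmax_rev L y : rmax (rev_seq L y) L = psum y L + rmax (neg_seq y) L.
Proof.
apply/eqP; rewrite eq_le; apply/andP; split.
  have [s sL ->] := rmax_attained (rev_seq L y) L.
  rewrite psum_rev// lerD2l -psum_neg; apply: psum_le_rmax; exact: leq_subr.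
have [s sL ->] := rmax_attained (neg_seq y) L.
rewrite psum_neg -{1}(subKn sL) -psum_rev ?leq_subr//.
by apply: psum_le_rmax; exact: leq_subr.
Qed.

(** The minimum of the partial sums up to time [2 ^ q.+2], seen from the left
    end; [renv] is its mirror image, seen from the right end and measured from
    the last partial sum. *)
Definition env L y q : R := - rmax (neg_seq y) (minn L (2 ^ q.+2)).
Definition renv L y q : R := - rmax (rev_seq L y) (minn L (2 ^ q.+2)).

(** The dyadic paths from the two ends both reach the global minimum of the
    partial sums, one at time [2 ^ k] and the other at time [L - 2 ^ k]; joining
    them by a constant costs nothing. *)
Lemma dyadic_block_path y L k : (2 ^ k.+1 <= L < 2 ^ k.+2)%N ->
  exists M : nat -> R, [/\ M 0%N = 0, M L = psum y L,
    forall i, (i <= L)%N -> - rmax (neg_seq y) L <= M i <= psum y i &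
    \sum_(i < L) (M i.+1 - M i) ^+ 2 <=
      \sum_(q < k.+1) 2 * (env L y q ^+ 2 + renv L y q ^+ 2) / 2 ^+ q].
Proof.
move=> /andP[kL Lk].
have kk : (2 ^ k + 2 ^ k <= L)%N by rewrite addnn -mul2n -expnS.
have min_homo q : (minn L (2 ^ q.+2) <= minn L (2 ^ q.+3))%N.
  by rewrite leq_min geq_minl/= (leq_trans (geq_minr _ _))// leq_exp2l.
have eS q : env L y q.+1 <= env L y q by rewrite lerN2 rmax_nondecreasing.
have reS q : renv L y q.+1 <= renv L y q by rewrite lerN2 rmax_nondecreasing.
have e0 q : env L y q <= 0 by rewrite oppr_le0 rmax_ge0.
have re0 q : renv L y q <= 0 by rewrite oppr_le0 rmax_ge0.
have mL : minn L (2 ^ k.+2) = L by apply/minn_idPl; exact: ltnW.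
(* the partial sums are only followed up to time L *)
have eleS q i : (i <= 2 ^ q.+1)%N -> env L y q <= psum y (minn i L).
  move=> iq; rewrite lerNl -psum_neg psum_le_rmax// leq_min geq_minr/=.
  by rewrite (leq_trans (geq_minl _ _))// (leq_trans iq)// leq_exp2l.
have releS q i : (i <= 2 ^ q.+1)%N -> renv L y q <= - psum (rev_seq L y) (minn i L).
  move=> iq; rewrite lerN2 psum_le_rmax// leq_min geq_minr/=.
  by rewrite (leq_trans (geq_minl _ _))// (leq_trans iq)// leq_exp2l.
have z0 : psum y (minn 0 L) = 0 by rewrite min0n psum0.
have rz0 : - psum (rev_seq L y) (minn 0 L) = 0 by rewrite min0n psum0 oppr0.
have [M1 [M10 M1k M1S cM1]] := dyadic_path z0 eS e0 eleS k.
have [M2 [M20 M2k M2S cM2]] := dyadic_path rz0 reS re0 releS k.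
have ek : env L y k = - rmax (neg_seq y) L by rewrite /env mL.
have rek : renv L y k = - rmax (neg_seq y) L - psum y L by rewrite /renv mL rmax_rev; ring.
set mu := - rmax (neg_seq y) L in ek rek *.
rewrite ek in M1k M1S; rewrite rek in M2k M2S.
pose M i := if (i <= 2 ^ k)%N then M1 i
  else if (i <= L - 2 ^ k)%N then mu else psum y L + M2 (L - i)%N.
have ME1 i : (i <= 2 ^ k)%N -> M i = M1 i by rewrite /M => ->.
have ME2 i : (2 ^ k <= i <= L - 2 ^ k)%N -> M i = mu.
  move=> /andP[h1 h2]; rewrite /M h2; case: ifP => // h3.
  by have -> : i = (2 ^ k)%N by lia.
have ME3 i : (L - 2 ^ k <= i <= L)%N -> M i = psum y L + M2 (L - i)%N.
  move=> /andP[h1 h2]; have [h3|h3] := leqP i (L - 2 ^ k).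
    have -> : i = (L - 2 ^ k)%N by lia.
    rewrite ME2 ?leqnn ?andbT; last by lia.
    by rewrite subKn; [rewrite M2k; ring|lia].
  by rewrite /M (leqNgt i (L - _)) h3 /= leqNgt (leq_ltn_trans _ h3)//; lia.
have Ssum i : (i <= L)%N -> mu <= psum y i.
  by move=> iL; rewrite /mu lerNl -psum_neg psum_le_rmax.
exists M; split.
- by rewrite ME1.
- by rewrite ME3 ?leqnn ?leq_subr// subnn M20 addr0.
- move=> i iL; have [h1|h1] := leqP i (2 ^ k).
    by rewrite ME1//; have := M1S _ h1; rewrite (minn_idPl iL).
  have [h2|h2] := leqP i (L - 2 ^ k).
    by rewrite ME2 ?lexx ?Ssum//; lia.
  rewrite ME3; last by lia.
  have h3 : (L - i <= 2 ^ k)%N by lia.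
  have := M2S _ h3; rewrite (minn_idPl (leq_subr _ _)) psum_rev ?leq_subr// subKn//.
  by move=> /andP[? ?]; apply/andP; split; lra.
- have -> : \sum_(q < k.+1) 2 * (env L y q ^+ 2 + renv L y q ^+ 2) / 2 ^+ q =
      \sum_(q < k.+1) 2 * env L y q ^+ 2 / 2 ^+ q +
      \sum_(q < k.+1) 2 * renv L y q ^+ 2 / 2 ^+ q.
    by rewrite -big_split; apply: eq_bigr => q _ /=; rewrite mulrDr mulrDl.
  apply: le_trans (lerD cM1 cM2).
  rewrite -(big_mkord xpredT (fun i => (M i.+1 - M i) ^+ 2)).
  rewrite (@big_cat_nat _ _ _ (2 ^ k)%N)//=; last by lia.
  rewrite (@big_cat_nat _ _ _ (L - 2 ^ k)%N (2 ^ k)%N)//=; [|by lia|by lia].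
  rewrite [X in _ + (X + _)]big_nat_cond [X in _ + (X + _)]big1 ?add0r; last first.
    by move=> i; rewrite andbT => h; rewrite !ME2 ?subrr ?expr0n//; lia.
  rewrite big_mkord lerD//.
    by apply: ler_sum => i _; have := ltn_ord i => h; rewrite !ME1//; lia.
  rewrite big_nat_rev/= -{1}[(L - 2 ^ k)%N]add0n big_addn subKn; last by lia.
  rewrite big_mkord; apply: ler_sum => i _; have := ltn_ord i => h.
  set j := (L - 2 ^ k + L - (i + (L - 2 ^ k)).+1)%N.
  rewrite !ME3; [|by rewrite /j; lia|by rewrite /j; lia].
  have -> : (L - j = i.+1)%N by rewrite /j; lia.
  have -> : (L - j.+1 = i)%N by rewrite /j; lia.
  by have -> : psum y L + M2 i - (psum y L + M2 i.+1) = - (M2 i.+1 - M2 i); [ring|rewrite sqrrN].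
Qed.
(** Bounds the energy of [y] on the event that two partial sums differ by more
    than [Lam]: there one of the factors [expR (t * _)] exceeds 1, and
    [4 * sigma ^+ 2 * (_ + _)] dominates [y i ^+ 2].  Exponentials of linear forms
    replace the indicator because their means are explicit. *)
Definition excursion_cost (sigma t Lam : R) L y : R :=
  \sum_(i < L) \sum_(j < L.+1) \sum_(l < L.+1)
    4 * sigma ^+ 2 * (expR (sigma^-1 * y i) + expR (- (sigma^-1 * y i))) *
    expR (t * (psum y j - psum y l - Lam)).

Definition block_cost (sigma t Lam : R) L y : R :=
  y 0%N ^+ 2 +
  \sum_(q < trunc_log 2 L) 2 * (env L y q ^+ 2 + renv L y q ^+ 2) / 2 ^+ q +
  excursion_cost sigma t Lam L y.

Lemma excursion_cost_term_ge0 (sigma t Lam a b : R) :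
  0 <= 4 * sigma ^+ 2 * (expR a + expR b) * expR (t * Lam).
Proof.
apply: mulr_ge0; last exact: expR_ge0.
apply: mulr_ge0; last by rewrite addr_ge0 ?expR_ge0.
by rewrite mulr_ge0 ?sqr_ge0.
Qed.

Lemma block_cost_ge0 (sigma t Lam : R) L y : 0 <= block_cost sigma t Lam L y.
Proof.
rewrite !addr_ge0 ?sqr_ge0//.
  by apply: sumr_ge0 => q _; rewrite divr_ge0 ?exprn_ge0// mulr_ge0 ?addr_ge0 ?sqr_ge0.
by do 3! apply: sumr_ge0 => ? _; exact: excursion_cost_term_ge0.
Qed.

(** [W] is the gap between the partial sums and the path of
    [dyadic_block_path]; it is at most the oscillation of the partial sums.
    If this exceeds [Lam], or if the block has a single point, [W] is 0. *)
Lemma block_dual (sigma t Lam : R) L y : 0 < sigma -> 0 <= t -> 0 <= Lam -> (0 < L)%N ->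
  exists W : nat -> R, [/\ W 0%N = 0, W L = 0,
    forall i, (i <= L)%N -> 0 <= W i <= Lam &
    \sum_(i < L) (y i - (W i.+1 - W i)) ^+ 2 <= block_cost sigma t Lam L y].
Proof.
move=> s0 t0 Lam0 L0.
have D0 : 0 <= \sum_(q < trunc_log 2 L) 2 * (env L y q ^+ 2 + renv L y q ^+ 2) / 2 ^+ q.
  by apply: sumr_ge0 => q _; rewrite divr_ge0 ?exprn_ge0// mulr_ge0 ?addr_ge0 ?sqr_ge0.
have X0 : 0 <= excursion_cost sigma t Lam L y.
  do 3! apply: sumr_ge0 => ? _; exact: excursion_cost_term_ge0.
have y0 := sqr_ge0 (y 0%N).
have [L1|L1] := leqP L 1.
  have L1E : L = 1%N by lia.
  exists (fun=> 0); split => //; first by move=> i _; rewrite lexx.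
  apply: (@le_trans _ _ (y 0%N ^+ 2)); last by rewrite /block_cost; lra.
  by rewrite L1E big_ord_recr big_ord0/= subrr subr0 add0r.
have [/existsP[j /existsP[l jl]]|] :=
    boolP [exists j : 'I_L.+1, exists l : 'I_L.+1, Lam < psum y j - psum y l].
  exists (fun=> 0); split => //; first by move=> i _; rewrite lexx.
  apply: (@le_trans _ _ (excursion_cost sigma t Lam L y)); last by rewrite /block_cost; lra.
  apply: ler_sum => i _; rewrite subrr subr0.
  rewrite (bigD1 j)//= (bigD1 l)//=.
  rewrite -[leLHS]addr0 lerD//; last first.
    apply: sumr_ge0 => ? _; apply: sumr_ge0 => ? _; exact: excursion_cost_term_ge0.
  rewrite -[leLHS]addr0 lerD//; last first.
    apply: sumr_ge0 => ? _; exact: excursion_cost_term_ge0.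
  have h := sqr_le_expR (sigma^-1 * y i).
  have e1 : 1 <= expR (t * (psum y j - psum y l - Lam)).
    by rewrite -expR0 ler_expR mulr_ge0// subr_ge0 ltW.
  have -> : y i ^+ 2 = sigma ^+ 2 * (sigma^-1 * y i) ^+ 2.
    by field; rewrite gt_eqF.
  have s2 : 0 <= sigma ^+ 2 by exact: sqr_ge0.
  set E := _ + _ in h *.
  have E0 : 0 <= E by rewrite addr_ge0 ?expR_ge0.
  apply: (le_trans (ler_wpM2l s2 h)).
  have -> : sigma ^+ 2 * (4 * E) = 4 * sigma ^+ 2 * E by ring.
  by rewrite ler_peMr// mulr_ge0// mulr_ge0.
rewrite negb_exists => /forallP nj.
have small j l : (j <= L)%N -> (l <= L)%N -> psum y j - psum y l <= Lam.
  move=> jL lL; have := nj (inord j); rewrite negb_exists => /forallP/(_ (inord l)).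
  by rewrite -leNgt !inordK.
have tl0 : (0 < trunc_log 2 L)%N by rewrite trunc_log_gt0.
have bnd : (2 ^ (trunc_log 2 L).-1.+1 <= L < 2 ^ (trunc_log 2 L).-1.+2)%N.
  by rewrite prednK//; apply: trunc_log_bounds => //; lia.
have [M [M0 ML MS cM]] := dyadic_block_path y bnd.
exists (fun i => psum y i - M i); split.
- by rewrite psum0 M0 subrr.
- by rewrite ML subrr.
- move=> i iL; have /andP[h1 h2] := MS _ iL.
  rewrite subr_ge0 h2/=.
  have [s sL rE] := rmax_attained (neg_seq y) L.
  rewrite rE psum_neg opprK in h1.
  by have := small _ _ iL sL; lra.
- apply: (@le_trans _ _ (\sum_(i < L) (M i.+1 - M i) ^+ 2)).
    by apply: ler_sum => i _; rewrite psumS le_eqVlt; apply/orP; left; apply/eqP; ring.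
  rewrite prednK// in cM; apply: (le_trans cM); rewrite /block_cost; lra.
Qed.
End block.

(** * Mean cost of a block *)

Lemma excursion_count (L N : nat) : (0 < L)%N -> (L <= N)%N ->
  (L.+1 * L.+1 * L <= 4 * N ^ 3)%N.
Proof.
move=> L0 LN; have L2 : (L.+1 <= 2 * N)%N by lia.
apply: (leq_trans (leq_mul (leq_mul L2 L2) LN)).
by rewrite !expnS expn0; lia.
Qed.

Section block_cost_mean.
Variables (R : realType) (d : measure_display) (T : measurableType d)
  (P : probability T R) (n : nat) (Y : 'I_n -> {RV P >-> R})
  (theta : 'rV[R]_n) (sigma : R).
Hypotheses (s0 : 0 < sigma) (gY : gaussian_vector Y theta sigma).
Local Notation noise := (noise Y theta).
Variable p : nat -> 'I_n.
Hypothesis pK : forall i, (i < n)%N -> p i = i :> nat.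

Lemma neg_scaleE c (q : nat -> 'I_n) w :
  neg_seq (fun s => c * noise (q s) w) = (fun s => - c * noise (q s) w).
Proof. by apply/funext => s; rewrite /neg_seq mulNr. Qed.

Lemma sum_block (f : 'I_n -> R) a j : (a + j <= n)%N ->
  \sum_(s < j) f (p (a + s)) = \sum_(m < n) (a <= m < a + j)%N%:R * f m.
Proof.
elim: j => [_|j IH ajn].
  rewrite big_ord0 big1// => m _; rewrite addn0.
  by rewrite (_ : (_ <= _ < _)%N = false) ?mul0r//; lia.
rewrite big_ord_recr/= IH; last by lia.
have pa : p (a + j) = (a + j)%N :> nat by rewrite pK; lia.
transitivity (\sum_(m < n) ((a <= m < a + j)%N%:R * f m + (m == p (a + j))%:R * f m)).
  rewrite big_split/=; congr (_ + _).
  rewrite (bigD1 (p (a + j)))//= eqxx mul1r big1 ?addr0// => m /negPf ->.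
  by rewrite mul0r.
apply: eq_bigr => m _; rewrite -mulrDl -natrD; congr (_%:R * _).
rewrite -(inj_eq val_inj)/= pa; case: (ltngtP m (a + j)) => h; lia.
Qed.

(** The exponent is a linear form of the noise with squared coefficients summing
    to at most 2 t^2 L + 2 / sigma^2, plus the constant [- t * Lam]. *)
Lemma excursion_term_mean c sgn (t Lam : R) a i j l L : c ^+ 2 = 1 -> sgn ^+ 2 = 1 ->
    (i < L)%N -> (j <= L)%N -> (l <= L)%N -> (a + L <= n)%N ->
  (\int[P]_w (expR (sgn * (sigma^-1 * (c * noise (p (a + i)) w)) +
     t * (psum (fun s => c * noise (p (a + s)) w) j
        - psum (fun s => c * noise (p (a + s)) w) l - Lam)))%:E
   <= (expR (1 + sigma ^+ 2 * t ^+ 2 * L%:R - t * Lam))%:E)%E.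
Proof.
move=> c2 sg2 iL jL lL aL.
pose coef (m : 'I_n) : R := c * (t * ((a <= m < a + j)%N%:R - (a <= m < a + l)%N%:R)
   + sgn * (m == p (a + i))%:R / sigma).
have coefE w : sgn * (sigma^-1 * (c * noise (p (a + i)) w)) +
     t * (psum (fun s => c * noise (p (a + s)) w) j
        - psum (fun s => c * noise (p (a + s)) w) l - Lam) =
   \sum_m coef m * noise m w - t * Lam.
  have ps j' : (j' <= L)%N -> psum (fun s => c * noise (p (a + s)) w) j' =
      c * \sum_(m < n) (a <= m < a + j')%N%:R * noise m w.
    move=> jL'; rewrite /psum -mulr_sumr (sum_block (fun m => noise m w))//.
    by apply: leq_trans aL; rewrite leq_add2l.
  rewrite !ps//.
  have -> : noise (p (a + i)) w = \sum_m (m == p (a + i))%:R * noise m w.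
    rewrite (bigD1 (p (a + i)))//= eqxx mul1r big1 ?addr0// => m /negPf ->.
    by rewrite mul0r.
  rewrite mulrBr addrA; congr (_ - _).
  rewrite !mulr_sumr -sumrB mulr_sumr -big_split/=.
  by apply: eq_bigr => m _; rewrite /coef; ring.
under eq_integral do rewrite coefE addrC expRD.
rewrite ge0_integralZ_EFin ?expR_ge0//; last first.
  apply: measurableT_comp => //; apply: measurable_sum_cond => m _.
  by apply: measurable_funM => //; exact: measurable_noise.
rewrite (noise_mgf s0 gY) -EFinM lee_fin -expRD ler_expR addrC lerD2r.
have sc m : coef m ^+ 2 <= 2 * t ^+ 2 * (a <= m < a + L)%N%:R
     + 2 * sigma ^- 2 * (m == p (a + i))%:R.
  rewrite /coef exprMn c2 mul1r.
  set x := t * _; set y := _ / sigma.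
  have h : (x + y) ^+ 2 <= 2 * x ^+ 2 + 2 * y ^+ 2.
    by have := sqr_ge0 (x - y); nra.
  apply: (le_trans h); apply: lerD.
    rewrite /x exprMn -mulrA ler_pM2l// ler_wpM2l ?sqr_ge0//.
    have [h1|h1] := boolP (a <= m < a + L)%N.
      by case: (a <= m < a + j)%N; case: (a <= m < a + l)%N => /=; rewrite ?subrr ?subr0 ?sub0r ?sqrrN ?expr1n ?expr0n/=.
    have -> : (a <= m < a + j)%N = false by lia.
    have -> : (a <= m < a + l)%N = false by lia.
    by rewrite subrr expr0n.
  rewrite /y !exprMn sg2 mul1r exprVn; case: eqP => _ /=; rewrite ?expr1n ?expr0n/= ?mul1r ?mulr1 ?mul0r ?mulr0//.
have S1 : \sum_m coef m ^+ 2 <= 2 * t ^+ 2 * L%:R + 2 * sigma ^- 2.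
  apply: (@le_trans _ _ (\sum_(m < n) (2 * t ^+ 2 * (a <= m < a + L)%N%:R
     + 2 * sigma ^- 2 * (m == p (a + i))%:R))).
    by apply: ler_sum => m _; exact: sc.
  rewrite big_split/= -!mulr_sumr.
  have -> : \sum_(m < n) (a <= m < a + L)%N%:R = L%:R :> R.
    under eq_bigr do rewrite -[_%:R]mulr1.
    by rewrite -(sum_block (fun=> 1) aL) sumr_const card_ord.
  rewrite [X in _ + _ * X](bigD1 (p (a + i)))//= eqxx big1 ?addr0 ?mulr1//.
  by move=> m /negPf ->.
have s2 : 0 < sigma ^+ 2 by rewrite exprn_gt0.
have S2 : 2 * sigma ^- 2 * sigma ^+ 2 = 2 by rewrite -mulrA mulVf ?mulr1 ?gt_eqF.
rewrite ler_pdivrMr//; apply: (le_trans (ler_wpM2r (ltW s2) S1)).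
by rewrite mulrDl S2; lra.
Qed.

Lemma measurable_noise_psum_rmax c (q : nat -> 'I_n) j :
  measurable_fun setT (fun w => psum (fun s => c * noise (q s) w) j) /\
  measurable_fun setT (fun w => rmax (fun s => c * noise (q s) w) j).
Proof.
apply: measurable_psum_rmax => s _.
by apply: measurable_funM => //; exact: measurable_noise.
Qed.

Lemma measurable_env c (q : nat -> 'I_n) L k :
  measurable_fun setT (fun w => env L (fun s => c * noise (q s) w) k) /\
  measurable_fun setT (fun w => renv L (fun s => c * noise (q s) w) k).
Proof.
split; apply: measurableT_comp => //.
  by under eq_fun do rewrite neg_scaleE; case: (measurable_noise_psum_rmax (- c) q (minn L (2 ^ k.+2))).
by case: (measurable_noise_psum_rmax c (fun s => q (L.-1 - s)%N) (minn L (2 ^ k.+2))).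
Qed.

Lemma measurable_excursion_cost c t Lam L (q : nat -> 'I_n) :
  measurable_fun setT (fun w => excursion_cost sigma t Lam L (fun s => c * noise (q s) w)).
Proof.
have mz i : measurable_fun setT (fun w => c * noise (q i) w).
  by apply: measurable_funM => //; exact: measurable_noise.
apply: measurable_sum_cond => i _; apply: measurable_sum_cond => j _.
apply: measurable_sum_cond => l _.
have [mj _] := measurable_noise_psum_rmax c q j.
have [ml _] := measurable_noise_psum_rmax c q l.
apply: measurable_funM.
  apply: measurable_funM => //; apply: measurable_funD; apply: measurableT_comp => //.
    exact: measurable_funM.
  by apply: measurableT_comp => //; exact: measurable_funM.
apply: measurableT_comp => //; apply: measurable_funM => //.
by apply: measurable_funB => //; exact: measurable_funB.
Qed.

Lemma measurable_dyadic_cost c L K (q : nat -> 'I_n) :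
  measurable_fun setT (fun w => \sum_(k < K) 2 *
    (env L (fun s => c * noise (q s) w) k ^+ 2 + renv L (fun s => c * noise (q s) w) k ^+ 2) / 2 ^+ k).
Proof.
apply: measurable_sum_cond => k _; have [me mr] := measurable_env c q L k.
apply: measurable_funM => //; apply: measurable_funM => //.
by apply: measurable_funD; exact: measurable_funX.
Qed.

Lemma measurable_block_cost c t Lam L (q : nat -> 'I_n) :
  measurable_fun setT (fun w => block_cost sigma t Lam L (fun s => c * noise (q s) w)).
Proof.
apply: measurable_funD; last exact: measurable_excursion_cost.
apply: measurable_funD; last exact: measurable_dyadic_cost.
by apply: measurable_funX; apply: measurable_funM => //; exact: measurable_noise.
Qed.

(** There are at most log2 L scales, and expR (1/2) <= 2. *)
Lemma trunc_log_le_ln (N L : nat) (Lg : R) : (0 < L <= N)%N ->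
  expR Lg = expR 1 * N%:R -> (trunc_log 2 L)%:R <= 2 * Lg.
Proof.
move=> /andP[L0 LN] LgE; set k := trunc_log 2 L.
have kN : (2 ^ k <= N)%N by apply: leq_trans LN; exact: trunc_logP.
suff : k%:R * 2^-1 <= Lg by move=> h; lra.
rewrite -ler_expR LgE mulrC expRM_natr.
apply: (@le_trans _ _ (2 ^+ k)).
  by apply: lerXn2r; rewrite ?nnegrE ?expR_ge0 ?expR_half_le2.
rewrite -natrX; apply: (@le_trans _ _ N%:R); first by rewrite ler_nat.
by rewrite ler_peMl//; have := expR_ge1Dx (1 : R); lra.
Qed.

(** Each dyadic scale contributes at most 1024 sigma^2, by the maximal
    inequality, and there are at most [2 * Lg] of them.  With [t] minimizing
    sigma^2 t^2 h - t Lam, each of the at most 4 N^3 excursion terms has mean at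
    most 8 sigma^2 expR (1 - 3 Lg), where expR (- 3 Lg) is of order N^-3: this is
    what the factor 12 in [Lam] is for. *)
Lemma block_cost_mean c (Lg Lam : R) a h L N : c ^+ 2 = 1 ->
    (0 < L <= h)%N -> (h <= N)%N -> (a + L <= n)%N -> 1 <= Lg -> expR Lg = expR 1 * N%:R ->
    Lam ^+ 2 = 12 * sigma ^+ 2 * h%:R * Lg ->
  (\int[P]_w (block_cost sigma (Lam / (2 * sigma ^+ 2 * h%:R)) Lam L
                (fun s => c * noise (p (a + s)) w))%:E
   <= (2096 * sigma ^+ 2 * Lg)%:E)%E.
Proof.
move=> c2 /andP[L0 Lh] hN aL Lg1 LgE LamE.
set t := Lam / _.
have s2 : 0 < sigma ^+ 2 by rewrite exprn_gt0.
have h0 : 0 < h%:R :> R by rewrite ltr0n; lia.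
have mN i : measurable_fun setT (noise i) := measurable_noise Y theta i.
have pinj i j : (i < j < n)%N -> p i != p j.
  move=> ijn; rewrite -(inj_eq val_inj)/= !pK; lia.
pose z w s := c * noise (p (a + s)) w.
have menv q : measurable_fun setT (fun w => env L (z w) q).
  by case: (measurable_env c (fun s => p (a + s)%N) L q).
have mrenv q : measurable_fun setT (fun w => renv L (z w) q).
  by case: (measurable_env c (fun s => p (a + s)%N) L q).
have le_min q : (64 * (minn L (2 ^ q.+2))%:R * sigma ^+ 2 <= 256 * 2 ^+ q * sigma ^+ 2).
  rewrite ler_pM2r//; apply: (@le_trans _ _ (64 * (2 ^ q.+2)%:R)).
    by rewrite ler_pM2l// ler_nat geq_minr.
  by rewrite natrX !exprS; lra.
have Eenv q : (\int[P]_w (env L (z w) q ^+ 2)%:E <= (256 * 2 ^+ q * sigma ^+ 2)%:E)%E.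
  apply: (@le_trans _ _ (64 * (minn L (2 ^ q.+2))%:R * sigma ^+ 2)%:E); last by rewrite lee_fin.
  under eq_integral do rewrite sqrrN neg_scaleE.
  apply: noise_rmax_sqr => //; first by rewrite sqrrN.
  by move=> r s rs; apply: pinj; have := geq_minl L (2 ^ q.+2); lia.
have Erenv q : (\int[P]_w (renv L (z w) q ^+ 2)%:E <= (256 * 2 ^+ q * sigma ^+ 2)%:E)%E.
  apply: (@le_trans _ _ (64 * (minn L (2 ^ q.+2))%:R * sigma ^+ 2)%:E); last by rewrite lee_fin.
  under eq_integral do rewrite sqrrN.
  apply: (@noise_rmax_sqr _ _ _ _ _ _ _ _ s0 gY c (fun s => p (a + (L.-1 - s))%N)) => //.
  by move=> r s rs; rewrite eq_sym; apply: pinj; have := geq_minl L (2 ^ q.+2); lia.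
pose D w := \sum_(q < trunc_log 2 L) 2 * (env L (z w) q ^+ 2 + renv L (z w) q ^+ 2) / 2 ^+ q.
have ED : (\int[P]_w (D w)%:E <= (2048 * sigma ^+ 2 * Lg)%:E)%E.
  have mE2 q : measurable_fun setT (fun w => env L (z w) q ^+ 2) by exact: measurable_funX.
  have mR2 q : measurable_fun setT (fun w => renv L (z w) q ^+ 2) by exact: measurable_funX.
  have DE w : D w = \sum_(q < trunc_log 2 L) (2 / 2 ^+ q) * (env L (z w) q ^+ 2 + renv L (z w) q ^+ 2).
    by apply: eq_bigr => q _; rewrite mulrAC.
  under eq_integral do rewrite DE.
  have q0 (q : nat) : 0 <= 2 / 2 ^+ q :> R by rewrite divr_ge0// exprn_ge0.
  have ER0 (q : nat) w : 0 <= env L (z w) q ^+ 2 + renv L (z w) q ^+ 2.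
    by rewrite addr_ge0 ?sqr_ge0.
  rewrite ge0_integral_sum_EFin; first last.
  - by move=> q w; rewrite mulr_ge0.
  - by move=> q _; apply: measurable_funM => //; exact: measurable_funD.
  apply: (@le_trans _ _ (\sum_(q < trunc_log 2 L) (1024 * sigma ^+ 2)%:E)%E).
    apply: lee_sum => q _; rewrite ge0_integralZ_EFin//; last exact: measurable_funD.
    rewrite ge0_integralD_EFin//; [|by move=> w; exact: sqr_ge0|by move=> w; exact: sqr_ge0].
    apply: (@le_trans _ _ ((2 / 2 ^+ q)%:E *
        ((256 * 2 ^+ q * sigma ^+ 2)%:E + (256 * 2 ^+ q * sigma ^+ 2)%:E))%E).
      by apply: lee_wpmul2l; [rewrite lee_fin|exact: leeD].
    rewrite -EFinD -EFinM lee_fin le_eqVlt; apply/orP; left; apply/eqP; field.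
    by rewrite expf_neq0.
  rewrite sumEFin lee_fin sumr_const card_ord -mulr_natr.
  have := @trunc_log_le_ln N L Lg; rewrite L0 (leq_trans Lh hN) => /(_ isT LgE).
  by move: s2; nra.
pose X w := excursion_cost sigma t Lam L (z w).
have EX : (\int[P]_w (X w)%:E <= (32 * sigma ^+ 2)%:E)%E.
  pose B := expR (1 - 3 * Lg).
  have BN : B * N%:R ^+ 3 <= 1.
    have e0 := expR_gt0 (1 : R).
    have E3 : expR (3 * Lg) = expR 1 ^+ 3 * N%:R ^+ 3 :> R.
      by rewrite -exprMn -LgE mulrC expRM_natr.
    have : B * expR (3 * Lg) = expR 1 by rewrite -expRD; congr expR; ring.
    rewrite E3 => h1.
    have e1 : 1 <= expR (1 : R) by rewrite -{1}expR0 ler_expR.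
    have B0 : 0 <= B * N%:R ^+ 3 by rewrite mulr_ge0 ?expR_ge0 ?exprn_ge0.
    have : expR (1 : R) * (B * N%:R ^+ 3) * expR 1 ^+ 2 = expR 1 * 1.
      by rewrite mulr1 -{}[RHS]h1; ring.
    rewrite -mulrA => /(mulfI (lt0r_neq0 e0)).
    have : 1 <= expR (1 : R) ^+ 2 by rewrite exprn_ege1.
    by nra.
  pose c0 := 4 * sigma ^+ 2.
  have c00 : 0 <= c0 by rewrite mulr_ge0 ?sqr_ge0.
  pose S j w := psum (z w) j.
  have mSS j : measurable_fun setT (S j) by case: (measurable_noise_psum_rmax c (fun s => p (a + s)%N) j).
  pose F sg i j l w := expR (sg * (sigma^-1 * z w i) + t * (S j w - S l w - Lam)).
  have mF sg i j l : measurable_fun setT (F sg i j l).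
    apply: measurableT_comp => //; apply: measurable_funD.
      by apply: measurable_funM => //; apply: measurable_funM => //; exact: measurable_funM.
    apply: measurable_funM => //; apply: measurable_funB => //; exact: measurable_funB.
  have F0 sg i j l w : 0 <= F sg i j l w by exact: expR_ge0.
  pose G i j l w := c0 * (F 1 i j l w + F (-1) i j l w).
  have mG i j l : measurable_fun setT (G i j l).
    by apply: measurable_funM => //; exact: measurable_funD.
  have G0 i j l w : 0 <= G i j l w by rewrite mulr_ge0// addr_ge0.
  have XE w : X w = \sum_(i < L) \sum_(j < L.+1) \sum_(l < L.+1) G i j l w.
    apply: eq_bigr => i _; apply: eq_bigr => j _; apply: eq_bigr => l _.
    by rewrite /G /F -mulrA !expRD mul1r mulN1r; congr (_ * _); rewrite mulrDl.
  have EG (i : 'I_L) (j l : 'I_L.+1) : (\int[P]_w (G i j l w)%:E <= (8 * sigma ^+ 2 * B)%:E)%E.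
    rewrite ge0_integralZ_EFin//; last 2 first.
      exact: measurable_funD.
      by move=> w; rewrite addr_ge0.
    rewrite ge0_integralD_EFin//.
    have EF sg : sg ^+ 2 = 1 -> (\int[P]_w (F sg i j l w)%:E <= B%:E)%E.
      move=> sg2; apply: (le_trans (excursion_term_mean _ _ c2 sg2 (ltn_ord i) _ _ aL)).
      - by rewrite -ltnS.
      - by rewrite -ltnS.
      rewrite lee_fin ler_expR.
      have Lhr : L%:R <= h%:R :> R by rewrite ler_nat.
      have h1 : sigma ^+ 2 * t ^+ 2 * L%:R <= sigma ^+ 2 * t ^+ 2 * h%:R.
        by rewrite ler_wpM2l// mulr_ge0 ?sqr_ge0.
      have h2 : sigma ^+ 2 * t ^+ 2 * h%:R = Lam ^+ 2 / (4 * sigma ^+ 2 * h%:R).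
        by rewrite /t; field; rewrite !gt_eqF.
      have h3 : t * Lam = Lam ^+ 2 / (2 * sigma ^+ 2 * h%:R).
        by rewrite /t; field; rewrite !gt_eqF.
      have h4 : Lam ^+ 2 / (4 * sigma ^+ 2 * h%:R) = 3 * Lg.
        by rewrite LamE; field; rewrite !gt_eqF.
      have h5 : Lam ^+ 2 / (2 * sigma ^+ 2 * h%:R) = 6 * Lg.
        by rewrite LamE; field; rewrite !gt_eqF.
      lra.
    apply: (@le_trans _ _ (c0%:E * (B%:E + B%:E))%E).
      by apply: lee_wpmul2l; [rewrite lee_fin|apply: leeD; apply: EF; rewrite ?sqrrN expr1n].
    by rewrite -EFinD -EFinM lee_fin /c0; lra.
  under eq_integral do rewrite XE.
  rewrite ge0_integral_sum_EFin; first last.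
  - by move=> i w; apply: sumr_ge0 => j _; exact: sumr_ge0.
  - by move=> i _; do 2! apply: measurable_sum_cond => ? _.
  apply: (@le_trans _ _ (\sum_(i < L) \sum_(j < L.+1) \sum_(l < L.+1) (8 * sigma ^+ 2 * B)%:E)%E).
    apply: lee_sum => i _; rewrite ge0_integral_sum_EFin; first last.
    - by move=> j w; apply: sumr_ge0.
    - by move=> j _; apply: measurable_sum_cond => ? _.
    apply: lee_sum => j _; rewrite ge0_integral_sum_EFin//.
    by apply: lee_sum => l _; exact: EG.
  under eq_bigr do under eq_bigr do rewrite sumEFin.
  under eq_bigr do rewrite sumEFin.
  rewrite sumEFin lee_fin !sumr_const !card_ord -!mulrnA -mulr_natr.
  have cnt : (L.+1 * L.+1 * L)%:R <= 4 * N%:R ^+ 3 :> R.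
    rewrite -natrX -natrM ler_nat.
    by apply: excursion_count => //; exact: leq_trans Lh hN.
  have B0 : 0 <= B by exact: expR_ge0.
  have := ler_wpM2l B0 cnt.
  move: s2; nra.
have D0 w : 0 <= D w.
  by apply: sumr_ge0 => q _; rewrite divr_ge0 ?exprn_ge0// mulr_ge0 ?addr_ge0 ?sqr_ge0.
have X0 w : 0 <= X w.
  by do 3! apply: sumr_ge0 => ? _; exact: excursion_cost_term_ge0.
have mz0 : measurable_fun setT (fun w => z w 0%N ^+ 2).
  by apply: measurable_funX; exact: measurable_funM.
have mD : measurable_fun setT D by exact: measurable_dyadic_cost.
have mX : measurable_fun setT X by exact: measurable_excursion_cost.
change (\int[P]_w (z w 0%N ^+ 2 + D w + X w)%:E <= (2096 * sigma ^+ 2 * Lg)%:E)%E.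
rewrite ge0_integralD_EFin//; last 2 first.
- exact: measurable_funD.
- by move=> w; rewrite addr_ge0 ?sqr_ge0.
rewrite ge0_integralD_EFin//; last by move=> w; exact: sqr_ge0.
have Ez : (\int[P]_w (z w 0%N ^+ 2)%:E <= (16 * sigma ^+ 2)%:E)%E.
  under eq_integral do rewrite /z exprMn c2 mul1r.
  exact: noise_sqr.
apply: (le_trans (leeD (leeD Ez ED) EX)).
by rewrite -!EFinD lee_fin; nra.
Qed.
End block_cost_mean.

(** * Dual paths on monotone pieces and their concatenation *)

Section segments.
Variables (R : realType) (u : nat -> R) (h : nat) (r Lam : R)
  (cost : nat -> (nat -> R) -> R).
Hypotheses (r0 : 0 <= r) (Lam0 : 0 <= Lam) (h0 : (0 < h)%N).
Hypothesis dual : forall L (y : nat -> R), (0 < L <= h)%N ->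
  exists W : nat -> R, [/\ W 0%N = 0, W L = 0,
    forall i, (i <= L)%N -> 0 <= W i <= Lam &
    \sum_(i < L) (y i - (W i.+1 - W i)) ^+ 2 <= cost L y].

Let lambda := 2 * Lam.

(** A sign, the first index and the length: the noise enters the cost of a block
    with that sign. *)
Definition block := (bool * nat * nat)%type.

Definition blocks_cost (bs : seq block) (z : nat -> R) : R :=
  \sum_(b <- bs) cost b.2 (fun i => (-1) ^+ b.1.1 * z (b.1.2 + i)%N).

(** The existence, for the noise [z], of a dual path on the edges [a], ..., [b]
    -- the edge [i] joins the coordinates [i.-1] and [i] -- with prescribed values
    at both ends, complementary to [theta] and of cost at most [D]. *)
Definition certificate (a b : nat) (alpha beta : R) (theta z : nat -> R) (D : R) :=
  exists W : nat -> R, [/\ W a = alpha, W b = beta,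
    forall i, (a <= i <= b)%N -> 0 <= W i <= lambda,
    forall i, (a < i < b)%N ->
      W i * (theta i.-1 - theta i) = lambda * Num.max (theta i.-1 - theta i) 0 &
    \sum_(a <= i < b) (z i - (W i.+1 - W i)) ^+ 2 <= D].

(** A piecewise constant approximation of [u] on the coordinates [a], ...,
    [b.-1], with first value [x] and last value [y], together with dual paths for
    all noises whose costs are controlled by at most [p] blocks.  The blocks and
    the approximation are fixed before the noise. *)
Definition segment (a b : nat) (alpha beta x y : R) (p : nat) (D : R) :=
  exists (bs : seq block) (theta : nat -> R), [/\ (size bs <= p)%N,
    all (fun b' : block => (0 < b'.2 <= h)%N && (b'.1.2 + b'.2 <= b)%N) bs,
    theta a = x /\ theta b.-1 = y,
    forall i, (a <= i < b)%N -> `|theta i - u i| <= r &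
    forall z, certificate a b alpha beta theta z (2 * blocks_cost bs z + D)].

(** Only the joint [b] has to be checked: [beta] must be complementary to the
    jump of the approximation there. *)
Lemma segment_cat a b c alpha beta gamma x y x' y' p p' D D' : (a < b < c)%N ->
    beta * (y - x') = lambda * Num.max (y - x') 0 ->
    segment a b alpha beta x y p D -> segment b c beta gamma x' y' p' D' ->
  segment a c alpha gamma x y' (p + p') (D + D').
Proof.
move=> /andP[ab bc] join [bs [th [sz val [tx ty] app cert]]]
  [bs' [th' [sz' val' [tx' ty'] app' cert']]].
exists (bs ++ bs'), (fun i => if (i < b)%N then th i else th' i); split.
- by rewrite size_cat leq_add.
- rewrite all_cat val' andbT; apply: sub_all val => b' /andP[-> /= h1].
  exact: leq_trans h1 (ltnW bc).
- by rewrite ab; split => //; rewrite ifF//; lia.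
- move=> i /andP[ai ic]; case: ltnP => ib; first by apply: app; rewrite ai.
  by apply: app'; rewrite ib.
move=> z; have [W [Wa Wb W0 Wc WD]] := cert z; have [W' [Wa' Wb' W0' Wc' WD']] := cert' z.
exists (fun i => if (i < b)%N then W i else W' i); split.
- by rewrite ab.
- by rewrite ifF//; lia.
- move=> i /andP[ai ic]; case: ltnP => ib; first by apply: W0; lia.
  by apply: W0'; lia.
- move=> i /andP[ai ic]; case: (ltngtP i b) => ib.
  + rewrite (_ : (i.-1 < b)%N); last by lia.
    by apply: Wc; lia.
  + rewrite (_ : (i.-1 < b)%N = false); last by lia.
    by apply: Wc'; lia.
  + rewrite {}ib in ai ic *; rewrite (_ : (b.-1 < b)%N); last by lia.
    by rewrite ty tx' Wa'.
- rewrite (@big_cat_nat _ _ _ b)//=; [|exact: ltnW|exact: ltnW].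
  have -> : 2 * blocks_cost (bs ++ bs') z + (D + D') =
      (2 * blocks_cost bs z + D) + (2 * blocks_cost bs' z + D').
    by rewrite /blocks_cost big_cat/=; ring.
  apply: lerD.
    apply: le_trans WD; rewrite !big_nat; apply: ler_sum => i /andP[ai ib].
    rewrite ib; case: ltnP => // ib'.
    by have -> : i.+1 = b by [lia]; rewrite Wa' Wb.
  apply: le_trans WD'; rewrite !big_nat; apply: ler_sum => i /andP[bi ic].
  by rewrite !ltnNge bi (leqW bi).
Qed.

(** A path from 0 to 0, added with the sign [s] to the linear path from [alpha]
    to [beta].  A path of sign -1 is made from the opposite noise, whose law is
    the same; it is used when the linear path lives in the upper half of
    [0, lambda]. *)
Lemma segment_block (s : bool) a L alpha beta x : (0 < L <= h)%N ->
    (forall w, 0 <= w <= Lam -> 0 <= alpha + (-1) ^+ s * w <= lambda /\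
                                0 <= beta + (-1) ^+ s * w <= lambda) ->
    (forall i, (a <= i < a + L)%N -> `|x - u i| <= r) ->
  segment a (a + L) alpha beta x x 1 (2 * (beta - alpha) ^+ 2 / L%:R).
Proof.
move=> Lh range app; have L0 : 0 < L%:R :> R by rewrite ltr0n; lia.
exists [:: (s, a, L)], (fun=> x); split => //=.
  by rewrite Lh leqnn.
move=> z; have [W [W0 WL Wr WD]] := dual (fun i => (-1) ^+ s * z (a + i)%N) Lh.
pose d := (beta - alpha) / L%:R.
have dL : d * L%:R = beta - alpha by rewrite mulfVK ?gt_eqF.
exists (fun i => alpha + d * (i - a)%:R + (-1) ^+ s * W (i - a)%N); split.
- by rewrite subnn W0 !mulr0 !addr0.
- by rewrite addKn WL mulr0 addr0 dL; ring.
- move=> i /andP[ai iL]; have iL' : (i - a <= L)%N by lia.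
  have [/andP[h1 h2] /andP[h3 h4]] := range _ (Wr _ iL').
  have k0 : 0 <= (i - a)%:R / L%:R :> R by rewrite divr_ge0.
  have k1 : (i - a)%:R / L%:R <= 1 :> R by rewrite ler_pdivrMr// mul1r ler_nat.
  set k := (i - a)%:R / L%:R in k0 k1 *.
  have -> : alpha + d * (i - a)%:R + (-1) ^+ s * W (i - a)%N =
     (1 - k) * (alpha + (-1) ^+ s * W (i - a)%N) + k * (beta + (-1) ^+ s * W (i - a)%N).
    by rewrite /d /k; ring.
  move: (alpha + _) h1 h2 => A h1 h2; move: (beta + _) h3 h4 => B h3 h4.
  by apply/andP; split; nra.
- by move=> i _; rewrite subrr maxxx !mulr0.
rewrite (addnC a L) -[X in \sum_(X <= _ < _) _]add0n big_addn addnK big_mkord.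
apply: (@le_trans _ _ (\sum_(i < L)
   (2 * ((-1) ^+ s * z (a + i)%N - (W i.+1 - W i)) ^+ 2 + 2 * d ^+ 2))).
  apply: ler_sum => i _; rewrite -addSn !addnK (addnC i a) -natr1.
  have sg : (-1) ^+ s * (-1) ^+ s = 1 :> R by rewrite -expr2 sqrr_sign.
  set E := (-1) ^+ s in sg *; set v := E * z (a + i)%N - _.
  have zE : z (a + i)%N = E * v + E * (W i.+1 - W i).
    by rewrite -mulrDr subrK mulrA sg mul1r.
  have -> : z (a + i)%N - (alpha + d * (i%:R + 1) + E * W i.+1 - (alpha + d * i%:R + E * W i))
      = E * v - d by rewrite zE; ring.
  have : (E * v) ^+ 2 = v ^+ 2 by rewrite exprMn expr2 sg mul1r.
  by have := sqr_ge0 (E * v + d); nra.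
rewrite big_split/= -mulr_sumr sumr_const card_ord /blocks_cost big_seq1/=.
rewrite lerD//; first by rewrite ler_pM2l.
rewrite /d -mulr_natr exprMn le_eqVlt; apply/orP; left; apply/eqP; field; exact: lt0r_neq0.
Qed.

Lemma segment_plain a L x : (0 < L <= h)%N ->
    (forall i, (a <= i < a + L)%N -> `|x - u i| <= r) ->
  segment a (a + L) 0 0 x x 1 0.
Proof.
move=> Lh app.
have := @segment_block false a L 0 0 x Lh _ app.
rewrite subrr expr0n/= mulr0 mul0r; apply => w /andP[w0 wL].
by rewrite /lambda expr0 mul1r add0r w0; split; lra.
Qed.

(** A descent from [lambda] to 0, or an ascent, is made of two such blocks, one
    in each half of [0, lambda]. *)
Lemma segment_drift a alpha beta x :
    (alpha = 0 /\ beta = Lam) \/ (alpha = lambda /\ beta = Lam) \/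
    (alpha = Lam /\ beta = 0) \/ (alpha = Lam /\ beta = lambda) ->
    (forall i, (a <= i < a + h)%N -> `|x - u i| <= r) ->
  segment a (a + h) alpha beta x x 1 (2 * Lam ^+ 2 / h%:R).
Proof.
move=> ab app; have hh : (0 < h <= h)%N by rewrite h0 leqnn.
have sq : (beta - alpha) ^+ 2 = Lam ^+ 2.
  by rewrite /lambda in ab; case: ab => [[-> ->]|[[-> ->]|[[-> ->]|[-> ->]]]]; ring.
rewrite -sq; apply: (@segment_block ((alpha == lambda) || (beta == lambda))) => // w /andP[w0 wL].
have [L0|L0] := eqVneq Lam 0.
  rewrite /lambda L0 mulr0 in ab wL *; have -> : w = 0 by lra.
  by rewrite mulr0; case: ab => [[-> ->]|[[-> ->]|[[-> ->]|[-> ->]]]]; rewrite addr0 lexx.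
have Lp : 0 < Lam by rewrite lt_neqAle eq_sym L0.
have n0 : (0 == lambda) = false by rewrite /lambda; apply/negbTE; rewrite eq_sym mulf_neq0.
have nL : (Lam == lambda) = false by rewrite /lambda; apply/negP => /eqP; lra.
case: ab => [[-> ->]|[[-> ->]|[[-> ->]|[-> ->]]]]; rewrite ?eqxx ?n0 ?nL /= ?orbT /= /lambda;
  rewrite ?expr0 ?expr1; split; apply/andP; split; lra.
Qed.

(** The first block is the longest one allowed by the two constraints, length at
    most [h] and oscillation at most [r].  When it stops before [b], either [h]
    steps are used up, or [u] has increased by more than [r]: one of the budgets
    [c], [q] decreases by 1. *)
Lemma greedy_segment k : forall q c a b, (c + q <= k)%N -> (a < b)%N ->
    (forall i j, (a <= i <= j)%N -> (j < b)%N -> u i <= u j) ->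
    u b.-1 - u a <= q%:R * r -> (b - a <= c * h)%N ->
  exists2 y, segment a b 0 0 (u a) y (c + q) 0 & y <= u b.-1.
Proof.
elim: k => [|k IH] q c a b ck ab mono uq ch.
  have c0 : c = 0%N by lia.
  by move: ch; rewrite c0 mul0n; lia.
have c0 : (0 < c)%N by case: c ch {ck} => //; rewrite mul0n; lia.
pose stop t := (a < t)%N && [|| t == b, t == (a + h)%N | u a + r < u t].
have ex : exists t, stop t by exists b; rewrite /stop ab eqxx.
case: (ex_minnP ex) => t /andP[at_ st] tmin.
have tb : (t <= b)%N by apply: tmin; rewrite /stop ab eqxx.
have th : (t <= a + h)%N by apply: tmin; rewrite /stop eqxx orbT; lia.
have first : segment a t 0 0 (u a) (u a) 1 0.
  rewrite -(subnKC (ltnW at_)); apply: segment_plain; first by lia.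
  rewrite subnKC; last exact: ltnW.
  move=> i /andP[ai it]; have [->|ia] := eqVneq i a; first by rewrite subrr normr0.
  have : ~~ stop i by apply: contraL it => /tmin; rewrite leqNgt.
  rewrite /stop (_ : (a < i)%N); last by lia.
  rewrite /= !negb_or -leNgt => /and3P[_ _ h1].
  have h2 : u a <= u i by apply: mono; lia.
  by rewrite ler_norml; apply/andP; split; lra.
have ub : u a <= u b.-1 by apply: mono; lia.
have [tbE|tnb] := eqVneq t b.
  exists (u a) => //; rewrite -tbE; move: first => [bs [th' [sz ? ? ? ?]]].
  by exists bs, th'; split => //; apply: leq_trans sz _; lia.
have tb' : (t < b)%N by rewrite ltn_neqAle tnb.
have mono' i j : (t <= i <= j)%N -> (j < b)%N -> u i <= u j.
  by move=> ij jb; apply: mono => //; lia.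
have ut : u a <= u t by apply: mono; lia.
have glue c' q' : (c' + q' < c + q)%N -> u b.-1 - u t <= q'%:R * r -> (b - t <= c' * h)%N ->
    exists2 y, segment a b 0 0 (u a) y (c + q) 0 & y <= u b.-1.
  move=> cq' uq' ch'.
  have [|y sy yb] := IH q' c' t b _ tb' mono' uq' ch'; first by lia.
  exists y => //.
  have join : 0 * (u a - u t) = lambda * Num.max (u a - u t) 0.
    by rewrite mul0r max_r ?mulr0// subr_le0.
  have := segment_cat _ join first sy; rewrite at_ tb' addr0 => /(_ isT).
  move=> [bs [th' [sz ? ? ? ?]]].
  by exists bs, th'; split => //; apply: (leq_trans sz); clear -cq'; lia.
move: st; rewrite (negPf tnb)/= => /orP[/eqP tE|ur].
  apply: (glue c.-1 q); first by lia.
    by apply: le_trans uq; rewrite lerD2l lerN2.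
  by rewrite tE subnDA -(subn1 c) mulnBl mul1n leq_sub2r.
have q0 : (0 < q)%N.
  case: q uq {ck glue} => // uq; exfalso; rewrite mul0r in uq.
  have h1 : u t <= u b.-1 by apply: mono; lia.
  rewrite subr_le0 in uq.
  by have := lt_le_trans ur (le_trans h1 uq); rewrite ltNge lerDl r0.
apply: (glue c q.-1); first by lia.
  by move: uq; rewrite -{1}(prednK q0) -natr1; lra.
by apply: leq_trans ch; lia.
Qed.

Lemma segment_joint_eq beta x : beta * (x - x) = lambda * Num.max (x - x) 0.
Proof. by rewrite subrr maxxx !mulr0. Qed.

Lemma segment_joint_le x y : x <= y -> 0 * (x - y) = lambda * Num.max (x - y) 0.
Proof. by move=> xy; rewrite mul0r max_r ?mulr0// subr_le0. Qed.

(** Two blocks of length exactly [h] at each end move the dual path between its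
    prescribed end values and 0, through [Lam]; the middle is cut greedily. *)
Lemma monotone_piece_segment N c q a alpha beta : (4 * h <= N)%N -> (N <= c * h)%N ->
    (alpha = 0 \/ alpha = lambda) -> (beta = 0 \/ beta = lambda) ->
    (forall i j, (a <= i <= j)%N -> (j < a + N)%N -> u i <= u j) ->
    u (a + N).-1 - u a <= q%:R * r ->
    (forall i, (i < 2 * h)%N -> u (a + i) - u a <= r) ->
    (forall i, (a + N - 2 * h <= i < a + N)%N -> u (a + N).-1 - u i <= r) ->
  segment a (a + N) alpha beta (u a) (u (a + N - 2 * h)) (4 + (c + q)) (8 * Lam ^+ 2 / h%:R).
Proof.
move=> hN Nc alphaE betaE mono uq startr endr.
have app1 i : (a <= i < a + 2 * h)%N -> `|u a - u i| <= r.
  move=> /andP[ai ih].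
  have := startr (i - a)%N; rewrite subnKC// => /(_ _)h1.
  have {}h1 : u i - u a <= r by apply: h1; lia.
  have h2 : u a <= u i by apply: mono; lia.
  by rewrite ler_norml; apply/andP; split; lra.
set g := (a + N - 2 * h)%N.
have app2 i : (g <= i < a + N)%N -> `|u g - u i| <= r.
  move=> /andP[gi iN].
  have h1 : u (a + N).-1 - u g <= r by apply: endr; rewrite /g; lia.
  have h2 : u g <= u i by apply: mono; rewrite /g in gi *; lia.
  have h3 : u i <= u (a + N).-1 by apply: mono; rewrite /g in gi *; lia.
  by rewrite ler_norml; apply/andP; split; lra.
have F1 : segment a (a + h) alpha Lam (u a) (u a) 1 (2 * Lam ^+ 2 / h%:R).
  apply: segment_drift; first by case: alphaE => ->; tauto.
  by move=> i ih; apply: app1; lia.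
have F2 : segment (a + h) (a + h + h) Lam 0 (u a) (u a) 1 (2 * Lam ^+ 2 / h%:R).
  apply: segment_drift; first by tauto.
  by move=> i ih; apply: app1; lia.
have G1 : segment g (g + h) 0 Lam (u g) (u g) 1 (2 * Lam ^+ 2 / h%:R).
  apply: segment_drift; first by tauto.
  by move=> i ih; apply: app2; rewrite /g in ih *; lia.
have G2 : segment (g + h) (g + h + h) Lam beta (u g) (u g) 1 (2 * Lam ^+ 2 / h%:R).
  apply: segment_drift; first by case: betaE => ->; tauto.
  by move=> i ih; apply: app2; rewrite /g in ih *; lia.
have F := segment_cat _ (segment_joint_eq Lam (u a)) F1 F2.
have {}F := F (ltac:(lia)).
have G := segment_cat _ (segment_joint_eq Lam (u g)) G1 G2.
have {}G := G (ltac:(lia)).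
have gE : (g + h + h = a + N)%N by rewrite /g; lia.
rewrite gE in G.
have weaken p p' D D' y y' : (p <= p')%N -> D = D' -> y = y' ->
    segment a (a + N) alpha beta (u a) y p D -> segment a (a + N) alpha beta (u a) y' p' D'.
  move=> pp -> -> [bs [th' [sz ? ? ? ?]]]; exists bs, th'; split => //.
  exact: leq_trans sz pp.
have h0' : h%:R != 0 :> R by rewrite pnatr_eq0 -lt0n.
have [N4|N4] := eqVneq N (4 * h)%N.
  have ag : (a + h + h = g)%N by rewrite /g; lia.
  rewrite ag in F.
  have ug : u a <= u g by apply: mono; rewrite /g; lia.
  have agN : (a < g < a + N)%N by rewrite /g; lia.
  apply: weaken (segment_cat agN (segment_joint_le ug) F G) => //; by field.
have [||||y sy yg] := @greedy_segment (c + q) q c (a + h + h) g (leqnn _).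
- by rewrite /g; lia.
- by move=> i j ij jg; apply: mono; rewrite /g in jg; lia.
- apply: le_trans uq; apply: lerB; apply: mono; rewrite /g; lia.
- by apply: leq_trans Nc; rewrite /g; lia.
have u1 : u a <= u (a + h + h) by apply: mono; lia.
have u2 : y <= u g by apply: (le_trans yg); apply: mono; rewrite /g; lia.
have ahg : (a < a + h + h < g)%N by rewrite /g; lia.
have H1 := segment_cat ahg (segment_joint_le u1) F sy.
have agN : (a < g < a + N)%N by rewrite /g; lia.
apply: weaken (segment_cat agN (segment_joint_le u2) H1 G) => //; [by lia|by field].
Qed.

(** Between two pieces the dual path is [lambda] or 0 according to whether the
    approximation drops or not; its last value on a piece is
    [u (m * N - 2 * h)]. *)
Lemma piecewise_monotone_segment N c q m : (4 * h <= N)%N -> (N <= c * h)%N ->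
    (forall k, (k < m)%N -> [/\
      forall i j, (k * N <= i <= j)%N -> (j < k * N + N)%N -> u i <= u j,
      u (k * N + N).-1 - u (k * N) <= q%:R * r,
      forall i, (i < 2 * h)%N -> u (k * N + i) - u (k * N) <= r &
      forall i, (k * N + N - 2 * h <= i < k * N + N)%N -> u (k * N + N).-1 - u i <= r]) ->
  (0 < m)%N -> forall beta, (beta = 0 \/ beta = lambda) ->
  segment 0 (m * N) 0 beta (u 0%N) (u (m * N - 2 * h)) (m * (4 + (c + q)))
    (m%:R * (8 * Lam ^+ 2 / h%:R)).
Proof.
move=> hN Nc; elim: m => // m IH pieces _ beta betaE.
have [m0|m0] := posnP m.
  rewrite m0 !mul1n mul1r -(add0n N).
  have [//|mono uq us ue] := pieces 0%N.
  by apply: monotone_piece_segment => //; [left].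
have {}IH := IH (fun k km => pieces k (ltnW km)) m0.
have [//|mono uq us ue] := pieces m.
pose b := if u (m * N)%N < u (m * N - 2 * h)%N then lambda else 0.
have bE : b = 0 \/ b = lambda by rewrite /b; case: ifP; tauto.
have join : b * (u (m * N - 2 * h)%N - u (m * N)%N) =
    lambda * Num.max (u (m * N - 2 * h)%N - u (m * N)%N) 0.
  rewrite /b; case: ltP => hu; first by rewrite max_l// subr_ge0 ltW.
  by rewrite segment_joint_le.
have S := monotone_piece_segment hN Nc bE betaE mono uq us ue.
have := segment_cat _ join (IH b bE) S.
rewrite -[(_ + _.+1.+3)%N]/(m * (4 + (c + q)) + (4 + (c + q)))%N.
have -> : (m * N + N = m.+1 * N)%N by lia.
have -> : (m * (4 + (c + q)) + (4 + (c + q)) = m.+1 * (4 + (c + q)))%N by lia.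
have -> : m%:R * (8 * Lam ^+ 2 / h%:R) + 8 * Lam ^+ 2 / h%:R =
   m.+1%:R * (8 * Lam ^+ 2 / h%:R) by rewrite -natr1; ring.
apply; apply/andP; split; first by rewrite muln_gt0 m0; lia.
by rewrite ltn_mul2r; lia.
Qed.
End segments.

(** * The oracle inequality *)

Section estimator.
Variables (R : realType) (n : nat).
Implicit Types (y t : 'rV[R]_n).

Lemma sq_l2norm_ge0 t : 0 <= sq_l2norm t.
Proof. by apply: sumr_ge0 => i _; exact: sqr_ge0. Qed.

Lemma penalty_ge0 t : 0 <= nearly_isotonic_penalty t.
Proof.
by apply: sumr_ge0 => i _; apply: sumr_ge0 => k _; rewrite le_max lexx orbT.
Qed.

Lemma penalty_convex t t' s : 0 <= s <= 1 ->
  nearly_isotonic_penalty (t + s *: (t' - t)) <=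
  (1 - s) * nearly_isotonic_penalty t + s * nearly_isotonic_penalty t'.
Proof.
move=> /andP[s0 s1]; rewrite /nearly_isotonic_penalty !mulr_sumr -big_split/=.
apply: ler_sum => i _; rewrite !mulr_sumr -big_split/=.
apply: ler_sum => k _; rewrite !mxE.
have s1' : 0 <= 1 - s by rewrite subr_ge0.
set a := t 0 i - t 0 k; set b := t' 0 i - t' 0 k.
have -> : t 0 i + s * (t' 0 i - t 0 i) - (t 0 k + s * (t' 0 k - t 0 k)) =
    (1 - s) * a + s * b by rewrite /a /b; ring.
rewrite ge_max; apply/andP; split.
  by apply: lerD; rewrite ler_wpM2l// le_max lexx.
by rewrite addr_ge0// mulr_ge0// le_max lexx orbT.
Qed.

Lemma continuous_objective lambda y : continuous (nearly_isotonic_objective lambda y).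
Proof.
have cc i : continuous (fun t => t 0 i : R) by exact: coord_continuous.
have cst (a : R) : continuous (fun t : 'rV[R]_n => a) by exact: cst_continuous.
have cD (f g : 'rV[R]_n -> R) : continuous f -> continuous g ->
    continuous (fun t => f t + g t) by move=> cf cg t; exact: (continuousD (cf t) (cg t)).
have cB (f g : 'rV[R]_n -> R) : continuous f -> continuous g ->
    continuous (fun t => f t - g t) by move=> cf cg t; exact: (continuousB (cf t) (cg t)).
have cM (f g : 'rV[R]_n -> R) : continuous f -> continuous g ->
    continuous (fun t => f t * g t) by move=> cf cg t; exact: (continuousM (cf t) (cg t)).
have cS (I : Type) (s : seq I) (q : pred I) (f : I -> 'rV[R]_n -> R) :
    (forall i, continuous (f i)) -> continuous (fun t => \sum_(i <- s | q i) f i t).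
  move=> cf; elim: s => [|i s IH].
    by rewrite [X in continuous X](_ : _ = fun=> 0)//; apply/funext => t'; rewrite big_nil.
  rewrite [X in continuous X](_ : _ =
      fun t => (if q i then f i t else 0) + \sum_(j <- s | q j) f j t).
    by apply: (cD) => //; case: (q i).
  by apply/funext => t'; rewrite big_cons; case: (q i); rewrite ?add0r.
have maxE (a : R) : Num.max a 0 = 2^-1 * (a + `|a|).
  have [a0|a0] := leP 0 a; first by rewrite ger0_norm//; lra.
  by rewrite ltr0_norm//; lra.
have -> : nearly_isotonic_objective lambda y = fun t =>
    2^-1 * (\sum_i (y 0 i - t 0 i) * (y 0 i - t 0 i)) +
    lambda * \sum_(i < n) \sum_(k < n | k == i.+1 :> nat)
      2^-1 * ((t 0 i - t 0 k) + `|t 0 i - t 0 k|).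
  apply/funext => t; rewrite /nearly_isotonic_objective; congr (_ * _ + _ * _).
    by apply: eq_bigr => i _; rewrite !mxE expr2.
  by apply: eq_bigr => i _; apply: eq_bigr => k _; rewrite maxE.
apply: (cD); apply: (cM) => //; apply: (cS) => i.
  by apply: (cM); exact: (cB).
apply: (cS) => k; apply: (cM) => //; apply: (cD); first exact: (cB).
have csub : continuous (fun t => t 0 i - t 0 k : R) by exact: (cB).
by move=> t; exact: (continuous_comp (csub t) (@norm_continuous _ R^o _)).
Qed.

(** The sublevel set of [y] is compact: it is closed by continuity, and bounded
    because the quadratic part of the objective is at most its value at [y]. *)
Lemma objective_minimizer lambda y : 0 <= lambda ->
  exists t, forall t', nearly_isotonic_objective lambda y t <=
                       nearly_isotonic_objective lambda y t'.
Proof.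
move=> l0; pose F := nearly_isotonic_objective lambda y.
have cF : continuous F by exact: continuous_objective.
pose A := [set t | F t <= F y].
have [| | |c cA cmin] := @EVT_min_rV R n F A.
- by exists y; rewrite /A/=.
- apply: bounded_closed_compact; last first.
    rewrite (_ : A = F @^-1` [set x | x <= F y])//.
    by apply: closed_comp => [x _|]; [exact: cF|exact: closed_le].
  have B0 : 0 <= 1 + 2 * F y.
    by rewrite addr_ge0// mulr_ge0// addr_ge0 ?mulr_ge0 ?sq_l2norm_ge0 ?penalty_ge0 ?invr_ge0.
  exists (`|y| + (1 + 2 * F y)); split; first exact: num_real.
  move=> M MB t tA; apply: (le_trans _ (ltW MB)).
  have -> : t = y - (y - t) by rewrite opprB addrC subrK.
  apply: (le_trans (ler_normB _ _)); rewrite lerD2l.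
  rewrite [leLHS](_ : _ = mx_norm (y - t))// mx_normrE; apply: bigmax_le => // -[i j] _ /=.
  rewrite ord1.
  have h : (y 0 j - t 0 j) ^+ 2 <= 2 * F y.
    apply: (@le_trans _ _ (sq_l2norm (y - t))).
      rewrite /sq_l2norm (bigD1 j)//= !mxE lerDl; apply: sumr_ge0 => *; exact: sqr_ge0.
    have := tA; rewrite /A/= {1}/F /nearly_isotonic_objective => h.
    have := mulr_ge0 l0 (penalty_ge0 t); lra.
  rewrite !mxE; set x := y 0 j - t 0 j in h *.
  rewrite -(real_normK (num_real x)) in h.
  by have := sqr_ge0 (`|x| - 2^-1); nra.
- by apply: continuous_subspaceT => x; exact: cF.
exists c => t'; have [h|h] := leP (F t') (F y); first by apply: cmin; rewrite inE.
by apply: le_trans (ltW h); apply: cmin; rewrite inE /A/=.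
Qed.

Lemma estimator_min lambda y t : 0 <= lambda ->
  nearly_isotonic_objective lambda y (nearly_isotonic_estimator lambda y) <=
  nearly_isotonic_objective lambda y t.
Proof.
move=> l0; have := @objective_minimizer lambda y l0.
move=> /(xgetPex 0); exact.
Qed.

(** Rewrites the double sums of the definitions as sums over the edges. *)
Lemma sum_adjacent (G : nat -> nat -> R) :
  \sum_(i < n) \sum_(k < n | k == i.+1 :> nat) G i k = \sum_(1 <= i < n) G i.-1 i.
Proof.
case: n => [|n']; first by rewrite big_ord0 big_geq.
rewrite big_ord_recr/= [X in _ + X]big_pred0 ?addr0; last first.
  by move=> k; apply/negbTE; rewrite neq_ltn ltn_ord.
rewrite big_add1/= big_mkord; apply: eq_bigr => i _.
by rewrite (big_pred1 (lift ord0 i)).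
Qed.

Lemma summation_by_parts (W t : nat -> R) N : W 0%N = 0 -> W N = 0 ->
  \sum_(i < N) (W i.+1 - W i) * t i = \sum_(1 <= i < N) W i * (t i.-1 - t i).
Proof.
move=> W0; case: N => [_|N WN]; first by rewrite big_ord0 big_geq.
suff : \sum_(i < N.+1) (W i.+1 - W i) * t i =
    W N.+1 * t N + \sum_(1 <= i < N.+1) W i * (t i.-1 - t i).
  by rewrite WN mul0r add0r.
elim: N {WN} => [|N IH].
  by rewrite big_ord_recr big_ord0 big_geq//= W0; ring.
by rewrite big_ord_recr IH/= [in RHS]big_nat_recr//=; ring.
Qed.

Variable p : nat -> 'I_n.
Hypothesis pK : forall i : 'I_n, p i = i.

Lemma penaltyE t : nearly_isotonic_penalty t =
  \sum_(1 <= i < n) Num.max (t 0 (p i.-1) - t 0 (p i)) 0.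
Proof.
rewrite -(sum_adjacent (fun i k => Num.max (t 0 (p i) - t 0 (p k)) 0)).
by apply: eq_bigr => i _; apply: eq_bigr => k _; rewrite !pK.
Qed.

(** First-order optimality: comparing the estimator [th] with the point at
    distance [s] on the way to [t], dividing by [s], and letting [s] tend to 0. *)
Lemma estimator_variational lambda y t th : 0 <= lambda ->
    th = nearly_isotonic_estimator lambda y ->
  lambda * nearly_isotonic_penalty th + \sum_i (y 0 i - th 0 i) * (t 0 i - th 0 i)
    <= lambda * nearly_isotonic_penalty t.
Proof.
move=> l0 thE; set I := \sum_i _; set Q := sq_l2norm (t - th).
have Q0 : 0 <= Q by exact: sq_l2norm_ge0.
have main s : 0 <= s <= 1 ->
    s * (lambda * nearly_isotonic_penalty th + I - lambda * nearly_isotonic_penalty t)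
      <= s ^+ 2 * Q / 2.
  move=> s01; have := @estimator_min lambda y (th + s *: (t - th)) l0.
  rewrite -thE /nearly_isotonic_objective => h.
  have hp := penalty_convex th t s01.
  have {}hp := ler_wpM2l l0 hp.
  have -> : s ^+ 2 * Q / 2 = 2^-1 * sq_l2norm (y - (th + s *: (t - th)))
     - 2^-1 * sq_l2norm (y - th) + s * I.
    rewrite /Q /I /sq_l2norm -!mulrBr.
    rewrite mulrAC -sumrB !mulr_sumr -big_split/=.
    apply: eq_bigr => i _; by rewrite !mxE; field.
  nra.
set D := lambda * nearly_isotonic_penalty th + I - lambda * nearly_isotonic_penalty t in main.
suff : D <= 0 by rewrite /D; lra.
rewrite leNgt; apply/negP => D0.
have s0 : 0 < Q + D by lra.
(* If D were positive, the step s = D / (Q + D) would already contradict [main]. *)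
have [s [sE sp s1]] : exists s, [/\ s * (Q + D) = D, 0 < s & s <= 1].
  exists (D / (Q + D)); split; first by rewrite mulfVK ?gt_eqF.
    by rewrite divr_gt0.
  by rewrite ler_pdivrMr// mul1r lerDr.
have := main s; rewrite (ltW sp) s1 => /(_ isT).
have -> : s ^+ 2 * Q / 2 = s * ((D - s * D) / 2).
  by rewrite -{1}sE; ring.
rewrite ler_pM2l// => h.
have := mulr_gt0 sp D0; lra.
Qed.

(** By duality lambda * penalty is at least sum_i (W_(i+1) - W_i) t_i, with
    equality at the complementary [th].  Inserted in the variational inequality
    for the estimator e, this leaves an inner product of e - th with the
    residual; the difference of the two sides below is then a nonnegative
    multiple of it plus a square. *)
Lemma estimator_oracle lambda y ts (th W : nat -> R) : 0 <= lambda ->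
    W 0%N = 0 -> W n = 0 -> (forall i, (i <= n)%N -> 0 <= W i <= lambda) ->
    (forall i, (0 < i < n)%N ->
      W i * (th i.-1 - th i) = lambda * Num.max (th i.-1 - th i) 0) ->
  sq_l2norm (nearly_isotonic_estimator lambda y - ts) <=
    \sum_(i < n) (th i - ts 0 i) ^+ 2 +
    \sum_(i < n) (y 0 i - ts 0 i - (W i.+1 - W i)) ^+ 2.
Proof.
move=> l0 W0 Wn Wr Wc; pose t : 'rV[R]_n := \row_i th i.
have tp i : t 0 (p i) = th (p i) by rewrite mxE.
have pv (i : nat) : (i < n)%N -> p i = i :> nat.
  by move=> lt_in; rewrite (pK (Ordinal lt_in)).
set e := nearly_isotonic_estimator lambda y.
have pt : lambda * nearly_isotonic_penalty t = \sum_(i < n) (W i.+1 - W i) * th i.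
  rewrite summation_by_parts// penaltyE mulr_sumr !big_nat; apply: eq_bigr => i /andP[i0 iN].
  by rewrite Wc ?i0// !tp !pv//; lia.
have pe : \sum_(i < n) (W i.+1 - W i) * e 0 i <= lambda * nearly_isotonic_penalty e.
  have -> : \sum_(i < n) (W i.+1 - W i) * e 0 i = \sum_(i < n) (W i.+1 - W i) * e 0 (p i).
    by apply: eq_bigr => i _; rewrite pK.
  rewrite (summation_by_parts (fun i => e 0 (p i)))// penaltyE mulr_sumr !big_nat.
  apply: ler_sum => i /andP[i0 iN]; have /andP[w0 w1] := Wr i (ltnW iN).
  have [h|h] := leP 0 (e 0 (p i.-1) - e 0 (p i)); first by rewrite ler_wpM2r.
  by rewrite mulr0 mulr_ge0_le0// ltW.
have var := estimator_variational t l0 (erefl e); rewrite pt in var.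
have {}var := le_trans (lerD pe (lexx _)) var.
rewrite -subr_ge0; rewrite -subr_ge0 -big_split -sumrB/= in var.
have -> : \sum_(i < n) (th i - ts 0 i) ^+ 2 +
    \sum_(i < n) (y 0 i - ts 0 i - (W i.+1 - W i)) ^+ 2 - sq_l2norm (e - ts) =
  2 * \sum_(i < n) ((W i.+1 - W i) * th i -
      ((W i.+1 - W i) * e 0 i + (y 0 i - e 0 i) * (t 0 i - e 0 i))) +
  \sum_(i < n) (y 0 i - ts 0 i - (W i.+1 - W i) - (e 0 i - th i)) ^+ 2.
  rewrite /sq_l2norm -big_split -sumrB/= mulr_sumr -big_split/=.
  by apply: eq_bigr => i _; rewrite !mxE; ring.
apply: addr_ge0; first by rewrite mulr_ge0.
by apply: sumr_ge0 => i _; exact: sqr_ge0.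
Qed.
End estimator.

(** * The partition into intervals of equal length *)

Section partition.
Variables (n m : nat) (A : 'I_m -> {set 'I_n}) (N : nat).
Hypotheses (partA : consecutive_interval_partition A) (cardA : forall j, #|A j| = N).

Let multiplicity i (q : pred 'I_m) : (\sum_(j < m | q j) (i \in A j) <= 1)%N.
Proof.
have [_ /(_ i)[j [ij uj]] _ _] := partA.
rewrite big_mkcond (bigD1 j)//= big1 => [|k kj]; last first.
  by case: ifP => // _; apply/eqP; rewrite eqb0; apply: contraNN kj => /uj ->.
by rewrite addn0; case: (q j) => //; case: (i \in A j).
Qed.

Let count_cards (q : pred 'I_m) :
  (\sum_(j < m | q j) N = \sum_(i < n) \sum_(j < m | q j) (i \in A j))%N.
Proof.
rewrite exchange_big/=; apply: eq_bigr => j _.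
by rewrite -(cardA j) -sum1_card big_mkcond.
Qed.

Lemma partition_size : n = (m * N)%N.
Proof.
have := count_cards xpredT; rewrite sum_nat_const card_ord => ->.
rewrite (eq_bigr (fun=> 1%N)); first by rewrite sum1_card card_ord.
move=> i _; apply/eqP; rewrite eqn_leq multiplicity/=.
have [_ /(_ i)[j [ij _]] _ _] := partA.
by rewrite (bigD1 j)//= ij.
Qed.

(** Comparing cardinals: the sets before [A k] fit strictly below any [i] in
    [A k], and the indices up to [i] fit in the sets up to [A k]. *)
Lemma mem_partition j i : (i \in A j) = (j * N <= i < j * N + N)%N.
Proof.
have [_ ex _ ord] := partA.
have fwd (k : 'I_m) : i \in A k -> (k * N <= i < k * N + N)%N.
  move=> ik; apply/andP; split.
    have : (\sum_(j' < m | j' < k) N <= \sum_(i' < n | i' < i) 1)%N.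
      rewrite count_cards [leqRHS]big_mkcond/=; apply: leq_sum => i' _.
      case: ltnP => ii'; first exact: multiplicity.
      rewrite big1// => j' j'k; apply/eqP; rewrite eqb0; apply/negP => ij'.
      by have := ord _ _ _ _ j'k ij' ik; lia.
    rewrite -(big_ord_widen m (fun=> N)) ?(ltnW (ltn_ord k))//.
    rewrite -(big_ord_widen n (fun=> 1%N)) ?(ltnW (ltn_ord i))//.
    by rewrite !sum_nat_const !card_ord muln1.
  have : (\sum_(i' < n | i' < i.+1) 1 <= \sum_(j' < m | j' < k.+1) N)%N.
    rewrite count_cards [leqLHS]big_mkcond/=; apply: leq_sum => i' _.
    case: ltnP => ii' //; have [j' [ij' _]] := ex i'.
    have j'k : (j' < k.+1)%N.
      rewrite ltnS leqNgt; apply/negP => kj'.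
      by have := ord _ _ _ _ kj' ik ij'; lia.
    by rewrite (bigD1 j')//= ij'.
  rewrite -(big_ord_widen m (fun=> N)) ?ltn_ord//.
  rewrite -(big_ord_widen n (fun=> 1%N)) ?ltn_ord//.
  by rewrite !sum_nat_const !card_ord muln1; lia.
apply/idP/idP; first exact: fwd.
move=> /andP[h1 h2]; have [k [ik _]] := ex i; have /andP[h3 h4] := fwd _ ik.
suff -> : j = k by [].
apply: val_inj => /=; apply/eqP; rewrite eqn_leq; apply/andP; split.
  by rewrite -ltnS -(ltn_pmul2r (_ : 0 < N)%N); lia.
by rewrite -ltnS -(ltn_pmul2r (_ : 0 < N)%N); lia.
Qed.

(** Two strictly increasing sequences with the same elements are equal. *)
Lemma enum_val_partition j (k : 'I_#|A j|) : enum_val k = (j * N + k)%N :> nat.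
Proof.
have kN : (k < N)%N by rewrite -(cardA j).
have jN : (j * N + N <= n)%N by rewrite [leqRHS]partition_size addnC -mulSn leq_mul2r ltn_ord orbT.
have E : map val (enum (A j)) = iota (j * N) N.
  apply: (irr_sorted_eq ltn_trans ltnn).
  - rewrite sorted_map /enum_mem; apply: sorted_filter.
      by move=> a b c; exact: ltn_trans.
    by rewrite -sorted_map -enumT val_enum_ord iota_ltn_sorted.
  - exact: iota_ltn_sorted.
  - move=> i; rewrite mem_iota; apply/mapP/idP => [[x]|].
      by rewrite mem_enum mem_partition => ? ->.
    move=> ij; have iN : (i < n)%N by lia.
    by exists (Ordinal iN) => //; rewrite mem_enum mem_partition.
have := nth_iota 0 (j * N) kN; rewrite -E => <-.
rewrite (nth_map (enum_val k)); last by rewrite -cardE.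
by rewrite {1}/enum_val (set_nth_default (enum_val k))// -cardE.
Qed.
End partition.

Section pieces.
Variables (R : realType) (n m : nat) (A : 'I_m -> {set 'I_n}) (N : nat).
Hypotheses (partA : consecutive_interval_partition A) (cardA : forall j, #|A j| = N).
Variables (theta : 'rV[R]_n) (p : nat -> 'I_n).
Hypothesis pK : forall i : 'I_n, p i = i.
Local Notation u := (fun i => theta 0 (p i)).

Lemma subvectorE (j : 'I_m) (k : 'I_#|A j|) : subvector theta (A j) 0 k = u (j * N + k)%N.
Proof. by rewrite mxE -(enum_val_partition partA cardA) pK. Qed.

Lemma variation_ge (j : 'I_m) : (0 < N)%N ->
  u (j * N + N).-1 - u (j * N)%N <= vector_variation (subvector theta (A j)).
Proof.
move=> N0; rewrite /vector_variation.
rewrite (eq_bigr (fun i : 'I_#|A j| => \sum_(k < #|A j| | k == i.+1 :> nat)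
    `|u (j * N + i)%N - u (j * N + k)%N|)); last first.
  by move=> i _; apply: eq_bigr => k _; rewrite !subvectorE.
rewrite (sum_adjacent _ (fun i k => `|u (j * N + i)%N - u (j * N + k)%N|)) cardA.
have -> : (j * N + N).-1 = (j * N + N.-1)%N by lia.
have tel (f : nat -> R) K : f K - f 0%N <= \sum_(i < K) `|f i - f i.+1|.
  elim: K => [|K IH]; first by rewrite subrr big_ord0.
  rewrite big_ord_recr/=; have := ler_norm (f K.+1 - f K); rewrite distrC; lra.
have := tel (fun i => u (j * N + i)%N) N.-1; rewrite addn0.
by rewrite -[X in \sum_(1 <= i < X) _](prednK N0) big_add1/= big_mkord.
Qed.

(** The moderate growth condition compares [u] with the chord of the piece; the
    first and last [2 * h] indices lie in its lower and upper halves because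
    [4 * h <= N], and there the chord moves by at most (2 h - 1) / (N - 1) v,
    which is at most 2 h v / N. *)
Lemma piece_bounds (v : R) h (j : 'I_m) : 0 <= v -> (0 < h)%N -> (4 * h <= N)%N ->
    nondecreasing_vector (subvector theta (A j)) ->
    vector_variation (subvector theta (A j)) <= v ->
    moderate_growth (subvector theta (A j)) ->
  [/\ forall i k, (j * N <= i <= k)%N -> (k < j * N + N)%N -> u i <= u k,
      u (j * N + N).-1 - u (j * N)%N <= v,
      forall i, (i < 2 * h)%N -> u (j * N + i)%N - u (j * N)%N <= 2 * h%:R / N%:R * v &
      forall i, (j * N + N - 2 * h <= i < j * N + N)%N ->
        u (j * N + N).-1 - u i <= 2 * h%:R / N%:R * v].
Proof.
move=> v0 h0 hN mono var growth.
have N0 : (0 < N)%N by lia.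
set V := vector_variation _ in var growth.
have uV := variation_ge j N0; rewrite -/V in uV.
have lt_card i : (i < N)%N -> (i < #|A j|)%N by rewrite cardA.
have subE i (iN : (i < N)%N) : subvector theta (A j) 0 (Ordinal (lt_card _ iN)) = u (j * N + i)%N.
  by rewrite subvectorE.
have monou i k : (j * N <= i <= k)%N -> (k < j * N + N)%N -> u i <= u k.
  move=> /andP[ji ik] kN.
  have iN : (i - j * N < N)%N by lia.
  have kN' : (k - j * N < N)%N by lia.
  have := mono (Ordinal (lt_card _ iN)) (Ordinal (lt_card _ kN')).
  rewrite !subE !subnKC//; [|by lia]; apply => /=; lia.
have V0 : 0 <= V.
  by apply: sumr_ge0 => i _; apply: sumr_ge0 => k _.
have N1 : 0 < N.-1%:R :> R by rewrite ltr0n; lia.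
have Nr : 0 < N%:R :> R by rewrite ltr0n.
have frac i : (i < 2 * h)%N -> i%:R / N.-1%:R * V <= 2 * h%:R / N%:R * v.
  move=> ih; apply: ler_pM => //.
  rewrite ler_pdivrMr// mulrAC ler_pdivlMr// -natrM -!natrM ler_nat; nia.
have u1 : uphalf #|A j| = uphalf N by rewrite cardA.
have u2 : #|A j|.-1 = N.-1 by rewrite cardA.
have grow i (iN : (i < N)%N) :
    ((i < uphalf N)%N -> u (j * N + i)%N <= u (j * N)%N + i%:R / N.-1%:R * V) /\
    ((uphalf N <= i.+1)%N -> u (j * N)%N + i%:R / N.-1%:R * V <= u (j * N + i)%N).
  have := growth (Ordinal (lt_card _ N0)) (Ordinal (lt_card _ iN)) erefl.
  by rewrite -/V !subE /= u1 u2 addn0.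
split => //; first exact: le_trans uV var.
- move=> i ih; have iN : (i < N)%N by lia.
  have [/(_ _)g _] := grow _ iN.
  have {}g : u (j * N + i)%N <= u (j * N)%N + i%:R / N.-1%:R * V.
    by apply: g; rewrite uphalf_half; lia.
  have := frac _ ih; lra.
- move=> i /andP[hi iN].
  have iN' : (i - j * N < N)%N by lia.
  have [_ g] := grow _ iN'.
  have {}g : u (j * N)%N + (i - j * N)%N%:R / N.-1%:R * V <= u i.
    rewrite subnKC in g; last by lia.
    by apply: g; rewrite uphalf_half; lia.
  have ih : (N.-1 - (i - j * N) < 2 * h)%N by lia.
  have := frac _ ih.
  have -> : (N.-1 - (i - j * N))%N%:R / N.-1%:R * V =
      V - (i - j * N)%N%:R / N.-1%:R * V.
    rewrite natrB; last by lia.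
    by field; rewrite gt_eqF.
  lra.
Qed.
End pieces.

(** * Risk bounds *)

Section risk.
Variables (R : realType) (n : nat) (theta : 'rV[R]_n) (sigma : R) (p : nat -> 'I_n).
Hypotheses (s0 : 0 < sigma) (pK : forall i : 'I_n, p i = i).

Let pv (i : nat) : (i < n)%N -> p i = i :> nat.
Proof. by move=> lt_in; rewrite (pK (Ordinal lt_in)). Qed.

Local Notation risk P lambda Y :=
  (\int[P]_w (sq_l2norm (nearly_isotonic_estimator lambda (\row_i Y i w) - theta))%:E)%E.

(** The dual path 0 and [th = theta] in the oracle inequality. *)
Lemma risk_unpenalized d (T : measurableType d) (P : probability T R)
    (Y : 'I_n -> {RV P >-> R}) : gaussian_vector Y theta sigma ->
  (risk P 0 Y <= (n%:R * (16 * sigma ^+ 2))%:E)%E.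
Proof.
move=> gY; apply: (@le_trans _ _ (\int[P]_w (\sum_i noise Y theta i w ^+ 2)%:E)%E).
  apply: ge0_le_integral_nonmeasurable => w; rewrite lee_fin ?sq_l2norm_ge0//.
  apply: (le_trans (@estimator_oracle _ _ p pK 0 _ theta (fun i => theta 0 (p i))
    (fun=> 0) _ _ _ _ _)) => //.
  - by move=> i _; rewrite lexx.
  - by move=> i _; rewrite !mul0r.
  rewrite big1 ?add0r; last by move=> i _; rewrite pK subrr expr0n.
  by apply: ler_sum => i _; rewrite mxE !oppr0 addr0.
rewrite ge0_integral_sum_EFin; first last.
- by move=> i w; exact: sqr_ge0.
- by move=> i _; apply: measurable_funX; exact: measurable_noise.
apply: (@le_trans _ _ (\sum_(i < n) (16 * sigma ^+ 2)%:E)%E).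
  by apply: lee_sum => i _; exact: noise_sqr.
by rewrite sumEFin lee_fin sumr_const card_ord [leRHS]mulr_natl.
Qed.

Local Notation u := (fun i => theta 0 (p i)).

(** With v = V/m, the first term is the squared bias and the second the cost of
    the blocks, at most 4 m N/h of them, plus that of the descents and ascents,
    which is of the order of a block since Lam^2 / h is of order sigma^2 Lg.
    The constant is 16792 = 2 * 4 * 2096 + 24. *)
Lemma risk_penalized (Lg v : R) (N m h : nat) :
    n = (m * N)%N -> (0 < m)%N -> (0 < h)%N -> (4 * h <= N)%N -> 0 <= v ->
    1 <= Lg -> expR Lg = expR 1 * N%:R ->
    (forall k, (k < m)%N -> [/\
      forall i j, (k * N <= i <= j)%N -> (j < k * N + N)%N -> u i <= u j,
      u (k * N + N).-1 - u (k * N)%N <= v,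
      forall i, (i < 2 * h)%N -> u (k * N + i)%N - u (k * N)%N <= 2 * h%:R / N%:R * v &
      forall i, (k * N + N - 2 * h <= i < k * N + N)%N ->
        u (k * N + N).-1 - u i <= 2 * h%:R / N%:R * v]) ->
  exists2 lambda : R, 0 <= lambda &
    forall d (T : measurableType d) (P : probability T R) (Y : 'I_n -> {RV P >-> R}),
      gaussian_vector Y theta sigma ->
    (risk P lambda Y <=
      (n%:R * (4 * (h%:R * v / N%:R) ^+ 2 + 16792 * (sigma ^+ 2 * Lg / h%:R)))%:E)%E.
Proof.
move=> nE m0 h0 hN v0 Lg1 LgE pieces.
pose Lam := Num.sqrt (12 * sigma ^+ 2 * h%:R * Lg).
have hR : 0 < h%:R :> R by rewrite ltr0n.
have N0 : (0 < N)%N by lia.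
have leh : (h <= N)%N by lia.
have NR : 0 < N%:R :> R by rewrite ltr0n.
have mR : 0 < m%:R :> R by rewrite ltr0n.
have s2 : 0 < sigma ^+ 2 by rewrite exprn_gt0.
have Lg0 : 0 < Lg by lra.
have Lam0 : 0 <= Lam by exact: sqrtr_ge0.
have LamE : Lam ^+ 2 = 12 * sigma ^+ 2 * h%:R * Lg.
  by rewrite sqr_sqrtr// !mulr_ge0// ltW.
pose t := Lam / (2 * sigma ^+ 2 * h%:R).
have t0 : 0 <= t by rewrite divr_ge0// !mulr_ge0// ltW.
pose r := 2 * h%:R / N%:R * v.
have r0 : 0 <= r by rewrite mulr_ge0// divr_ge0.
have dual L (y : nat -> R) : (0 < L <= h)%N -> exists W : nat -> R, [/\ W 0%N = 0, W L = 0,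
    forall i, (i <= L)%N -> 0 <= W i <= Lam &
    \sum_(i < L) (y i - (W i.+1 - W i)) ^+ 2 <= block_cost sigma t Lam L y].
  by move=> /andP[L0 _]; exact: block_dual.
pose c := (N %/ h).+1.
have Nc : (N <= c * h)%N by rewrite ltnW// ltn_ceil.
have cr : v <= c%:R * r.
  have : N%:R <= c%:R * h%:R :> R by rewrite -natrM ler_nat.
  rewrite /r => h1; rewrite mulrA -[leLHS]mul1r ler_wpM2r//.
  by rewrite mulrA ler_pdivlMr// mul1r; lra.
have [bs [th [sz val _ app cert]]] := @piecewise_monotone_segment R u h r Lam
  (block_cost sigma t Lam) r0 Lam0 h0 dual N c c m hN Nc
  (fun k km => let: And4 a b e f := pieces k km in And4 a (le_trans b cr) e f) m0 0 (or_introl erefl).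
exists (2 * Lam); first by rewrite mulr_ge0.
move=> d T P Y gY.
have sg2 (s : bool) : ((-1) ^+ s) ^+ 2 = 1 :> R by rewrite sqrr_sign.
pose z w i := noise Y theta (p i) w.
pose X w := 2 * blocks_cost (block_cost sigma t Lam) bs (z w).
pose D := n%:R * r ^+ 2 + m%:R * (8 * Lam ^+ 2 / h%:R).
have D0 : 0 <= D.
  by rewrite addr_ge0// mulr_ge0 ?sqr_ge0// divr_ge0// mulr_ge0 ?sqr_ge0.
have cost0 L y : 0 <= block_cost sigma t Lam L y by exact: block_cost_ge0.
have bc0 w : 0 <= blocks_cost (block_cost sigma t Lam) bs (z w) by exact: sumr_ge0.
have mb (b : block) : measurable_fun setT (fun w =>
    block_cost sigma t Lam b.2 (fun i => (-1) ^+ b.1.1 * z w (b.1.2 + i)%N)).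
  exact: (@measurable_block_cost _ _ _ _ _ Y theta sigma _ _ _ _ (fun s => p (b.1.2 + s)%N)).
have mbc : measurable_fun setT (fun w => blocks_cost (block_cost sigma t Lam) bs (z w)).
  by apply: measurable_sum_cond => b _.
apply: (@le_trans _ _ (\int[P]_w (X w + D)%:E)%E).
  apply: ge0_le_integral_nonmeasurable => w; rewrite lee_fin ?sq_l2norm_ge0//.
  have [W [W0 Wn Wr Wc WD]] := cert (z w).
  rewrite -nE in Wn Wr Wc WD app.
  apply: (le_trans (@estimator_oracle _ _ p pK (2 * Lam) _ theta th W _ W0 Wn _ _)) => //.
  - by rewrite mulr_ge0.
  have -> : X w + D = n%:R * r ^+ 2 + (X w + m%:R * (8 * Lam ^+ 2 / h%:R)).
    by rewrite /D; ring.
  apply: lerD.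
    apply: (@le_trans _ _ (\sum_(i < n) r ^+ 2)).
      apply: ler_sum => i _; have := app i (ltn_ord i); rewrite pK => h1.
      by rewrite -(real_normK (num_real (th i - _))) lerXn2r ?nnegrE.
    by rewrite sumr_const card_ord [leRHS]mulr_natl.
  apply: le_trans WD; rewrite big_mkord; apply: ler_sum => i _.
  by rewrite mxE /z /noise pK.
rewrite ge0_integralD_EFin//; last 2 first.
- exact: measurable_funM.
- by move=> w; rewrite mulr_ge0.
rewrite integral_cst//= probability_setT mule1 ge0_integralZ_EFin//.
have Ebc : (\int[P]_w (blocks_cost (block_cost sigma t Lam) bs (z w))%:E
    <= ((size bs)%:R * (2096 * sigma ^+ 2 * Lg))%:E)%E.
  rewrite ge0_integral_sum_EFin//.
  have Eb (b : block) : (0 < b.2 <= h)%N && (b.1.2 + b.2 <= m * N)%N ->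
     (\int[P]_w (block_cost sigma t Lam b.2 (fun i => (-1) ^+ b.1.1 * z w (b.1.2 + i)%N))%:E
     <= (2096 * sigma ^+ 2 * Lg)%:E)%E.
    move=> /andP[bh bn]; rewrite -nE in bn.
    exact: (block_cost_mean s0 gY pv (sg2 _) bh leh bn Lg1 LgE LamE).
  elim: {X sz cert bc0 mbc} bs val => [_|b bs IH /= /andP[bv /IH{}IH]].
    by rewrite big_nil mul0r.
  by rewrite big_cons -natr1 mulrDl mul1r addrC EFinD leeD// Eb.
have szR : (size bs)%:R <= 4 * m%:R * (N%:R / h%:R) :> R.
  have cnt : ((4 + (c + c)) * h <= 4 * N)%N.
    rewrite /c; have := leq_divM N h; move: hN; clear; nia.
  apply: (@le_trans _ _ (m%:R * (4 + (c + c))%N%:R)); first by rewrite -natrM ler_nat.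
  rewrite [4 * _]mulrC -mulrA ler_wpM2l// mulrA ler_pdivlMr// -!natrM ler_nat.
  exact: cnt.
apply: (le_trans (leeD (lee_wpmul2l _ Ebc) (lexx _))); first by rewrite lee_fin.
rewrite -EFinM -EFinD lee_fin /D nE natrM LamE.
set K := sigma ^+ 2 * Lg.
have K0 : 0 <= K by rewrite mulr_ge0// ltW.
have x4 : 4 <= N%:R / h%:R :> R by rewrite ler_pdivlMr// -natrM ler_nat.
set x := N%:R / h%:R in szR x4.
have -> : m%:R * (8 * (12 * sigma ^+ 2 * h%:R * Lg) / h%:R) = 96 * (m%:R * K).
  by rewrite /K; field; rewrite gt_eqF.
have -> : m%:R * N%:R * (4 * (h%:R * v / N%:R) ^+ 2 + 16792 * (sigma ^+ 2 * Lg / h%:R)) =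
    m%:R * N%:R * r ^+ 2 + 16792 * (m%:R * K * x).
  by rewrite /K /x /r; field; rewrite !gt_eqF.
have -> : 2096 * sigma ^+ 2 * Lg = 2096 * K by rewrite /K mulrA.
have h1 := ler_wpM2r K0 szR.
have h2 : 4 * (m%:R * K) <= m%:R * K * x by rewrite mulrC ler_wpM2l// mulr_ge0.
have -> : 2 * ((size bs)%:R * (2096 * K)) = 4192 * ((size bs)%:R * K) by ring.
have h3 : 4 * m%:R * x * K = 4 * (m%:R * K * x) by ring.
rewrite h3 in h1; lra.
Qed.
End risk.

Lemma powR_two_thirds (R : realType) (x : R) : 0 <= x -> (x `^ (2 / 3)) ^+ 3 = x ^+ 2.
Proof.
move=> x0; rewrite -powR_mulrn ?powR_ge0// -powRrM -[RHS]powR_mulrn//.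
by congr (_ `^ _); field.
Qed.

Lemma le_of_cube (R : realType) (a b : R) : 0 <= a -> 0 <= b -> a ^+ 3 <= b ^+ 3 -> a <= b.
Proof. by move=> a0 b0; rewrite ler_pXn2r// nnegrE. Qed.

(** The two terms balance when h^3 V^2 = sigma^2 Lg n^2; [h] is the largest
    integer on the good side with [4 * h <= N].  If h = 1 is already too large,
    then [sigma ^+ 2 <= T1].  If [h] is limited by [N], the second term is of
    order [T2]; otherwise [h.+1 <= 2 * h] is too large and it is of order
    [T1].  The powers 2/3 are compared after taking cubes. *)
Lemma block_length_choice (R : realType) (c sigma V Lg : R) (n N : nat) :
    0 <= c -> 0 < sigma -> 0 <= V -> 1 <= Lg -> (0 < n)%N -> (4 <= N)%N ->
  let T1 := (sigma ^+ 2 * V * Lg / n%:R) `^ (2 / 3) in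
  let T2 := sigma ^+ 2 * Lg / N%:R in
  sigma ^+ 2 <= T1 \/
  exists h, [/\ (0 < h)%N, (4 * h <= N)%N &
    4 * (h%:R * V / n%:R) ^+ 2 + c * (sigma ^+ 2 * Lg / h%:R) <=
      (4 + 8 * c) * Num.max T1 T2].
Proof.
move=> c0 s0 V0 Lg1 n0 N4 T1 T2.
have nR : 0 < n%:R :> R by rewrite ltr0n.
have s2 : 0 < sigma ^+ 2 by rewrite exprn_gt0.
have Lg0 : 0 < Lg by lra.
have x0 : 0 <= sigma ^+ 2 * V * Lg / n%:R by rewrite divr_ge0// !mulr_ge0// ltW.
have T10 : 0 <= T1 by exact: powR_ge0.
have T20 : 0 <= T2 by rewrite divr_ge0// mulr_ge0// ltW.
have T1E : T1 ^+ 3 = (sigma ^+ 2 * V * Lg / n%:R) ^+ 2 by exact: powR_two_thirds.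
pose good h := [&& (0 < h)%N, (4 * h <= N)%N & h%:R ^+ 3 * V ^+ 2 <= sigma ^+ 2 * Lg * n%:R ^+ 2].
have [g1|g1] := boolP (good 1%N); last first.
  left; apply: le_of_cube => //; first exact: ltW.
  rewrite T1E.
  have h1 : sigma ^+ 2 * Lg * n%:R ^+ 2 < V ^+ 2.
    by move: g1; rewrite /good /= N4 /= expr1n mul1r -ltNge.
  have h2 : sigma ^+ 2 * Lg <= V ^+ 2 / n%:R ^+ 2.
    by rewrite ler_pdivlMr ?exprn_gt0// ltW.
  have -> : (sigma ^+ 2 * V * Lg / n%:R) ^+ 2 = (sigma ^+ 2 * Lg) ^+ 2 * (V ^+ 2 / n%:R ^+ 2).
    by field; rewrite gt_eqF.
  have h3 : sigma ^+ 2 <= sigma ^+ 2 * Lg by rewrite ler_peMr// ltW.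
  have -> : (sigma ^+ 2) ^+ 3 = (sigma ^+ 2) ^+ 2 * sigma ^+ 2 by ring.
  apply: ler_pM; [exact: sqr_ge0|exact: ltW| |exact: le_trans h3 h2].
  by rewrite lerXn2r ?nnegrE// ltW// mulr_gt0.
right.
have ub h : good h -> (h <= N)%N by move=> /and3P[_ h4 _]; clear -h4; lia.
case: (ex_maxnP (ex_intro _ 1%N g1) ub) => h gh hmax.
have /and3P[h0 hN hV] := gh.
have hR : 0 < h%:R :> R by rewrite ltr0n.
exists h; split => //.
have b1 : (h%:R * V / n%:R) ^+ 2 <= T1.
  apply: le_of_cube => //; first exact: sqr_ge0.
  rewrite T1E.
  have -> : ((h%:R * V / n%:R) ^+ 2) ^+ 3 = (h%:R ^+ 3 * V ^+ 2) ^+ 2 * (V ^+ 2 / n%:R ^+ 6).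
    by field; rewrite gt_eqF.
  have -> : (sigma ^+ 2 * V * Lg / n%:R) ^+ 2 =
      (sigma ^+ 2 * Lg * n%:R ^+ 2) ^+ 2 * (V ^+ 2 / n%:R ^+ 6).
    by field; rewrite gt_eqF.
  rewrite ler_wpM2r ?divr_ge0 ?sqr_ge0 ?exprn_ge0//.
  by rewrite lerXn2r ?nnegrE// ?mulr_ge0 ?exprn_ge0// ltW.
have b2 : sigma ^+ 2 * Lg / h%:R <= 8 * Num.max T1 T2.
  have [hN1|hN1] := leqP (4 * h.+1) N; last first.
    apply: (@le_trans _ _ (8 * T2)); last by rewrite ler_pM2l// le_max lexx orbT.
    have N8 : N%:R <= 8 * h%:R :> R by rewrite -natrM ler_nat; clear -hN1 h0; lia.
    have NR : 0 < N%:R :> R by rewrite ltr0n; clear -N4; lia.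
    rewrite /T2 ler_pdivrMr// [leRHS](_ : _ = sigma ^+ 2 * Lg * (8 * h%:R / N%:R)); last by ring.
    apply: ler_peMr; first by rewrite ltW// mulr_gt0.
    by rewrite ler_pdivlMr// mul1r.
  have ng : sigma ^+ 2 * Lg * n%:R ^+ 2 < h.+1%:R ^+ 3 * V ^+ 2.
    rewrite ltNge; apply/negP => h1.
    by have := hmax h.+1; rewrite /good hN1 h1 => /(_ isT); rewrite ltnn.
  apply: (@le_trans _ _ (8 * T1)); last by rewrite ler_pM2l// le_max lexx.
  apply: (@le_trans _ _ (2 * T1)); last by rewrite ler_wpM2r//; lra.
  apply: le_of_cube; [by rewrite divr_ge0// mulr_ge0// ltW|by rewrite mulr_ge0|].
  rewrite [leRHS]exprMn T1E.
  have h2 : h.+1%:R ^+ 3 <= 8 * h%:R ^+ 3 :> R.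
    rewrite -[8]/(2 ^ 3)%N%:R natrX -exprMn lerXn2r ?nnegrE ?mulr_ge0//.
    by rewrite -natrM ler_nat; clear -h0; lia.
  have h3 : sigma ^+ 2 * Lg * n%:R ^+ 2 <= 8 * h%:R ^+ 3 * V ^+ 2.
    by apply: (le_trans (ltW ng)); rewrite ler_wpM2r ?sqr_ge0.
  have -> : (sigma ^+ 2 * Lg / h%:R) ^+ 3 =
      (sigma ^+ 2 * Lg * n%:R ^+ 2) * ((sigma ^+ 2 * Lg) ^+ 2 / (h%:R ^+ 3 * n%:R ^+ 2)).
    by field; rewrite !gt_eqF.
  have -> : 2 ^+ 3 * (sigma ^+ 2 * V * Lg / n%:R) ^+ 2 =
      (8 * h%:R ^+ 3 * V ^+ 2) * ((sigma ^+ 2 * Lg) ^+ 2 / (h%:R ^+ 3 * n%:R ^+ 2)).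
    by field; rewrite !gt_eqF.
  by rewrite ler_wpM2r// divr_ge0 ?sqr_ge0// mulr_ge0 ?exprn_ge0.
have b3 : T1 <= Num.max T1 T2 by rewrite le_max lexx.
rewrite [leRHS]mulrDl; apply: lerD; first by rewrite ler_pM2l// (le_trans b1).
by rewrite [8 * c]mulrC -[leRHS]mulrA ler_wpM2l.
Qed.

Theorem corollary4p12 (R : realType) :
  exists C : R, 0 < C /\
  forall (sigma V : R) (n m : nat) (A : 'I_m -> {set 'I_n}) (theta : 'rV[R]_n),
    0 < sigma -> 0 <= V -> (1 <= n)%N -> (1 <= m)%N ->
    consecutive_interval_partition A ->
    (forall j k : 'I_m, #|A j| = #|A k|) ->
    2 <= n%:R / m%:R :> R ->
    (forall j : 'I_m, nondecreasing_vector (subvector theta (A j)) /\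
                      vector_variation (subvector theta (A j)) <= V / m%:R) ->
    (forall j : 'I_m, moderate_growth (subvector theta (A j))) ->
    exists lambda : R, 0 <= lambda /\
      forall (d : measure_display) (T : measurableType d) (P : probability T R)
             (Y : 'I_n -> {RV P >-> R}),
        gaussian_vector Y theta sigma ->
        ((n%:R^-1)%:E *
           'E_P[fun w => sq_l2norm
                  (nearly_isotonic_estimator lambda (\row_i Y i w) - theta)%R]
         <= (C * Num.max
               ((sigma ^+ 2 * V * ln (expR 1 * n%:R / m%:R) / n%:R) `^ (2 / 3))
               (sigma ^+ 2 * m%:R / n%:R * ln (expR 1 * n%:R / m%:R)))%:E)%E.
Proof.
(* The constant of [risk_penalized], kept abstract; 4 + 8 * c also has to exceed
   48 = 3 * 16, for the unpenalized case. *)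
have [c [c44 cE]] : exists c : R, 44 <= c /\ c = 16792.
  by exists 16792; split => //; lra.
have c0 : 0 <= c by apply: le_trans c44.
have K48 : 48 <= 4 + 8 * c by lra.
exists (4 + 8 * c); split; first exact: lt_le_trans K48.
move=> sigma V n m A theta s0 V0 n1 m1 partA eqA _ shape growth.
pose j0 : 'I_m := Ordinal m1; pose N := #|A j0|.
have cardA j : #|A j| = N by exact: eqA.
have nE : n = (m * N)%N := partition_size partA cardA.
have N0 : (0 < N)%N by rewrite lt0n; apply: contraTneq n1 => N0; rewrite nE N0 muln0.
pose p (i : nat) : 'I_n := insubd (Ordinal n1) i.
have pK (i : 'I_n) : p i = i by apply: val_inj; rewrite val_insubd ltn_ord.
have nR : 0 < n%:R :> R by rewrite ltr0n.
have mR : 0 < m%:R :> R by rewrite ltr0n.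
have NR : 0 < N%:R :> R by rewrite ltr0n.
have s2 : 0 < sigma ^+ 2 by rewrite exprn_gt0.
have enm : expR 1 * n%:R / m%:R = expR 1 * N%:R :> R.
  by rewrite nE natrM; field; rewrite gt_eqF.
rewrite enm; set Lg := ln (expR 1 * N%:R).
have LgE : expR Lg = expR 1 * N%:R by rewrite lnK// posrE mulr_gt0 ?expR_gt0.
have Lg1 : 1 <= Lg by rewrite -ler_expR LgE ler_peMr ?expR_ge0// ler1n.
have T2E : sigma ^+ 2 * m%:R / n%:R * Lg = sigma ^+ 2 * Lg / N%:R.
  by rewrite nE natrM; field; rewrite !gt_eqF.
rewrite T2E; set T1 := _ `^ _; set T2 := sigma ^+ 2 * Lg / N%:R.
have T1M : T1 <= Num.max T1 T2 by rewrite le_max lexx.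
have T2M : T2 <= Num.max T1 T2 by rewrite le_max lexx orbT.
have s2Lg : sigma ^+ 2 <= sigma ^+ 2 * Lg by rewrite ler_peMr// ltW.
have scale (x : \bar R) (b : R) : (x <= (n%:R * b)%:E)%E -> ((n%:R^-1)%:E * x <= b%:E)%E.
  move=> h; apply: (le_trans (lee_wpmul2l _ h)); first by rewrite lee_fin invr_ge0 ltW.
  by rewrite -EFinM mulKf ?gt_eqF.
have small : sigma ^+ 2 <= 3 * Num.max T1 T2 -> exists lambda : R, 0 <= lambda /\
    forall (d : measure_display) (T : measurableType d) (P : probability T R)
           (Y : 'I_n -> {RV P >-> R}), gaussian_vector Y theta sigma ->
      ((n%:R^-1)%:E * 'E_P[fun w => sq_l2norm
         (nearly_isotonic_estimator lambda (\row_i Y i w) - theta)%R]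
       <= ((4 + 8 * c) * Num.max T1 T2)%:E)%E.
  move=> h; exists 0; split => // d T P Y gY; rewrite unlock.
  apply: le_trans (scale _ _ (risk_unpenalized s0 pK gY)) _.
  rewrite lee_fin; apply: (@le_trans _ _ (48 * Num.max T1 T2)); last first.
    by rewrite ler_wpM2r// (le_trans _ T1M)// powR_ge0.
  by move: h; clear; lra.
have [N4|N4] := ltnP N 4.
  apply: small; apply: (@le_trans _ _ (3 * T2)); last by rewrite ler_pM2l.
  rewrite mulrA ler_pdivlMr// mulrC ler_pM//; first exact: ltW.
  by rewrite ler_nat.
have [sT|[h [h0 hN bound]]] := block_length_choice c0 s0 V0 Lg1 n1 N4.
  apply: small; apply: (le_trans sT); apply: (le_trans T1M).
  by rewrite ler_peMl ?ler1n// (le_trans _ T1M)// powR_ge0.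
rewrite -/T1 -/T2 in bound.
have v0 : 0 <= V / m%:R by rewrite divr_ge0.
have pieces (k : nat) : (k < m)%N -> [/\
    forall i j, (k * N <= i <= j)%N -> (j < k * N + N)%N -> theta 0 (p i) <= theta 0 (p j),
    theta 0 (p (k * N + N).-1) - theta 0 (p (k * N)%N) <= V / m%:R,
    forall i, (i < 2 * h)%N ->
      theta 0 (p (k * N + i)%N) - theta 0 (p (k * N)%N) <= 2 * h%:R / N%:R * (V / m%:R) &
    forall i, (k * N + N - 2 * h <= i < k * N + N)%N ->
      theta 0 (p (k * N + N).-1) - theta 0 (p i) <= 2 * h%:R / N%:R * (V / m%:R)].
  move=> km; have [mono var] := shape (Ordinal km).
  exact: (piece_bounds partA cardA pK v0 h0 hN mono var (growth (Ordinal km))).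
have [lambda l0 risk] := risk_penalized s0 pK nE m1 h0 hN v0 Lg1 LgE pieces.
exists lambda; split => // d T P Y gY; rewrite unlock.
apply: le_trans (scale _ _ (risk d T P Y gY)) _.
rewrite lee_fin -cE; apply: le_trans bound.
have -> : h%:R * (V / m%:R) / N%:R = h%:R * V / n%:R; last by [].
by rewrite nE natrM; field; rewrite !gt_eqF.
Qed.
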